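(* Let $e\geq 2$, let $N=\langle\sigma\rangle$ be cyclic of order $2^e$, and let $G$ be a transitive subgroup of $\mathrm{Hol}(N)$. Let $H$ be any subgroup of $G$ of index $2^e$ and $C=\mathrm{Core}_G(H)$. Then the following are equivalent: (1) $G/C$ is not isomorphic to any transitive subgroup $T$ of $\mathrm{Hol}(N)$ under an isomorphism that takes $H/C$ to $\mathrm{Stab}_T(1_N)$; (2) one of the following holds: (i) $|H\cap N|\geq 4$; (ii) $|H\cap N|=2$ and $G$ has no element of order $2^e$; (iii) $|H\cap N|=2$ and $H$ is not normal in $G$; (iv) $|H\cap N|=1$, $H=\langle[\sigma^u,\varphi_{-1}]\rangle$ for some odd integer $u$, $|G|=2^{e+1}$, $\mathrm{Stab}_G(1_N)=\langle\varphi_{1+2^{e-1}}\rangle$, and either $|G\cap N|\geq 8$ or $|G\cap N|=|[G,G]|=4$.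
   Context: For an odd integer $a$, $\varphi_a\in\mathrm{Aut}(N)$ denotes $\sigma\mapsto\sigma^a$. $\mathrm{Hol}(N)=N\rtimes\mathrm{Aut}(N)$; its elements are written $[\sigma^u,\varphi_a]$ with multiplication $[\sigma^u,\varphi_a][\sigma^v,\varphi_b]=[\sigma^{u+va},\varphi_{ab}]$, and $N$ and $\mathrm{Aut}(N)$ are identified with the subgroups of elements $[\sigma^u,\varphi_1]$ and $[1,\varphi_a]$ respectively. $\mathrm{Hol}(N)$ acts on $N$ by $[\sigma^u,\varphi_a]\cdot\sigma^v=\sigma^{u+av}$. A subgroup is transitive if this action restricted to it is transitive; $\mathrm{Stab}_T(1_N)=T\cap\mathrm{Aut}(N)$ is the stabiliser of the identity. $\mathrm{Core}_G(H)$ is the largest normal subgroup of $G$ contained in $H$; $[G,G]$ is the commutator subgroup. *)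

(* Defs.v *)
From HB Require Import structures.
From mathcomp Require Import all_boot all_order all_algebra all_fingroup all_solvable.
Set Implicit Arguments. Unset Strict Implicit. Unset Printing Implicit Defensive.
Import GRing.Theory FinRing.Theory.

(* The holomorph Hol(N) of N = <sigma> cyclic of order 2^e.
   N is identified with Z/2^e Z (sigma^u <-> u), Aut(N) with the unit group
   (Z/2^e Z)^x (phi_a <-> a).  An element [sigma^u, phi_a] is the pair (u, a),
   with the paper's multiplication [u,a][v,b] = [u + v a, a b]. *)
Definition hol (e : nat) := ('Z_(2 ^ e) * {unit 'Z_(2 ^ e)})%type.
HB.instance Definition _ e := Finite.on (hol e).

Section HolGroup.
Variable e : nat.
Local Notation Z := ('Z_(2 ^ e)).
Definition hol_mul (x y : hol e) : hol e :=
  ((x.1 + y.1 * val x.2)%R, (x.2 * y.2)%g).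
Definition hol_one : hol e := (0%R, 1%g).
Definition hol_inv (x : hol e) : hol e :=
  ((- (x.1 * val (x.2^-1)%g))%R, (x.2^-1)%g).
Lemma hol_mulA : associative hol_mul.
Proof.
case=> u a [v b] [w c]; rewrite /hol_mul /= mulgA; congr (_, _).
change (val (a * b)%g) with (val a * val b)%R.
by rewrite -addrA mulrDl -mulrA (mulrC (val b)).
Qed.
Lemma hol_mul1 : left_id hol_one hol_mul.
Proof. by case=> u a; rewrite /hol_mul /= add0r mulr1 mul1g. Qed.
Lemma hol_mulV : left_inverse hol_one hol_inv hol_mul.
Proof.
by case=> u a; rewrite /hol_mul /hol_inv /= mulVg addNr.
Qed.
HB.instance Definition _ := Finite_isGroup.Build (hol e) hol_mulA hol_mul1 hol_mulV.
End HolGroup.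

(* [sigma^u, phi_a] for integers u, a (a odd, so a is a unit mod 2^e;
   for even a the default unit 1 is used, never relevant below). *)
Definition holE (e : nat) (u a : int) : hol e :=
  ((u%:~R : 'Z_(2 ^ e))%R, insubd (1%g : {unit 'Z_(2 ^ e)}) (a%:~R : 'Z_(2 ^ e))%R).

Definition holN (e : nat) : {set hol e} := [set x : hol e | x.2 == 1%g].
Definition holAut (e : nat) : {set hol e} := [set x : hol e | x.1 == 0%R].

Definition hol_act (e : nat) (g : hol e) (v : 'Z_(2 ^ e)) : 'Z_(2 ^ e) :=
  (g.1 + val g.2 * v)%R.

Definition hol_transitive (e : nat) (T : {set hol e}) : Prop :=
  forall v w : 'Z_(2 ^ e), exists2 g, g \in T & hol_act g v = w.

Definition hol_stab (e : nat) (T : {set hol e}) : {set hol e} := T :&: holAut e.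

(* Main.v *)
(* Giving an isomorphism of G/C with a transitive subgroup of Hol(N) that takes H/C to
   the stabiliser of 1_N amounts to giving a character G -> (Z/2^e)^x and a crossed
   homomorphism c : G -> Z/2^e for it whose zero set is H.

   No such c exists in the listed cases.  A transitive T always has an element t with
   t^(2^(e-2)) outside the stabiliser, which settles (i) and (ii) by computing powers
   in G.  In a transitive T without elements of order 2^e, [sigma^u, phi_a] has u odd
   exactly when a = 3 mod 4; this determines which elements of T commute modulo
   sigma^(2^(e-1)), and (iii) and (iv) follow by comparison with commutators in G.

   Conversely, if H is normal and meets N in two elements, then G/H has a cyclic
   subgroup of index at most 2, and by the classification of such 2-groups it embeds
   regularly in Hol(N).  If H meets N trivially, then H is the graph of a crossed
   homomorphism on a group of units.  If that is a coboundary, H is conjugate in Hol(N)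
   to a group of automorphisms and the inclusion of the conjugate of G works; otherwise,
   up to conjugation, H contains either phi_(-1) and [sigma^(2^(e-1)), phi_b] with
   b = 1 mod 4, or is generated by [sigma, phi_(-1)], and c is written down. *)

(* Why the residue of a mod 4 governs everything: the n-th power of [sigma^u, phi_a] has first
   coordinate u(1 + a + ... + a^(n-1)). For a = 1 mod 4 a sum of 2^k terms is 2^k times an odd
   number; for a = 3 mod 4 the factor 1 + a contributes an extra 2. So the elements of order 2^e,
   which act as a single cycle, are those with u odd and a = 1 mod 4; the 2^(e-1)-th power of any
   other element is 1.

   The same sums explain which cohomology classes survive when H meets N trivially. Over a group of
   units 1 mod 4, which is cyclic, the order of a generator forces its first coordinate to be a
   multiple of a - 1, so one conjugation removes it. Only a further generator with a = 3 mod 4 can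
   obstruct, and its commutator with the first generator and its square leave just the two
   exceptional shapes of H. *)
Require Import Defs.
From HB Require Import structures.
From mathcomp Require Import all_boot all_order all_algebra all_fingroup all_solvable.
From mathcomp Require Import ring zify.
Set Implicit Arguments. Unset Strict Implicit. Unset Printing Implicit Defensive.
Import GRing.Theory.
Local Open Scope group_scope.

(* lia preprocesses the whole context, which is very slow once ring equations over
   Z/2^e are present. *)
Ltac nlia := repeat match goal with
  | H : is_true (leq _ _) |- _ => revert H
  | H : @eq nat _ _ |- _ => revert H end; clear; intros; lia.

(** Linear-combination certificates: the caller gives the coefficients of the equations used, and
    the remaining identity goes to [ring]. This is how relations between zero divisors, such as 8q =
    0, are exploited. *)
Lemma lincomb1 (R : pzRingType) (c x y p q : R) :
  p = q -> (x - y = c * (p - q))%R -> x = y.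
Proof. by move=> ->; rewrite subrr mulr0 => /eqP; rewrite subr_eq0 => /eqP. Qed.

Lemma lincomb2 (R : pzRingType) (c d x y p q r s : R) :
  p = q -> r = s -> (x - y = c * (p - q) + d * (r - s))%R -> x = y.
Proof. by move=> -> ->; rewrite !subrr !mulr0 addr0 => /eqP; rewrite subr_eq0 => /eqP. Qed.

Lemma lincomb3 (R : pzRingType) (c d f x y p q r s k l : R) :
  p = q -> r = s -> k = l ->
  (x - y = c * (p - q) + d * (r - s) + f * (k - l))%R -> x = y.
Proof. by move=> -> -> ->; rewrite !subrr !mulr0 !addr0 => /eqP; rewrite subr_eq0 => /eqP. Qed.

Arguments lincomb1 {R} c {x y p q}.
Arguments lincomb2 {R} c d {x y p q r s}.
Arguments lincomb3 {R} c d f {x y p q r s k l}.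

(** * The ring Z/2^e *)

Section TwoAdic.
Local Open Scope ring_scope.
Context {e : nat} (e_ge2 : (2 <= e)%N).
Local Notation Z := 'Z_(2 ^ e).
Implicit Types a b u v x y : Z.

Lemma expe_gt1 : (1 < 2 ^ e)%N.
Proof. by rewrite -{1}(expn0 2) ltn_exp2l // (leq_trans _ e_ge2). Qed.

Lemma Z2_val_natr x : (val x)%:R = x.
Proof. exact: natr_Zp. Qed.

Lemma Z2_natr_eq (m n : nat) : (m%:R == n%:R :> Z) = (m == n %[mod 2 ^ e]).
Proof.
by rewrite -(inj_eq val_inj) /= !(val_Zp_nat expe_gt1).
Qed.

Lemma Z2_natr_eq0 (n : nat) : (n%:R == 0 :> Z) = (2 ^ e %| n)%N.
Proof. by rewrite -[0]/(0%:R) Z2_natr_eq mod0n. Qed.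

Lemma Z2_exp2_eq0 k : ((2 : Z) ^+ k == 0) = (e <= k)%N.
Proof. by rewrite -natrX Z2_natr_eq0 dvdn_Pexp2l. Qed.

Lemma Z2_exp2e : (2 : Z) ^+ e = 0.
Proof. by apply/eqP; rewrite Z2_exp2_eq0. Qed.

Lemma Z2_annihilator k x :
  (k <= e)%N -> 2 ^+ k * x = 0 -> exists y, x = 2 ^+ (e - k) * y.
Proof.
move=> le_ke /eqP; rewrite -[x]Z2_val_natr -natrX -natrM Z2_natr_eq0.
rewrite -{1}(subnKC le_ke) expnD dvdn_pmul2l ?expn_gt0 // => /dvdnP[q ->].
by exists q%:R; rewrite natrM natrX mulrC.
Qed.

Lemma Z2_annihilator_val x :
  (2 * x == 0) = (x \in [:: 0; 2 ^+ e.-1]).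
Proof.
have e_gt0 : (0 < e)%N by exact: leq_trans e_ge2.
apply/eqP/idP => [|].
  rewrite -[X in X * x]expr1 => /(@Z2_annihilator 1 _)[|y ->]; first by [].
  rewrite subn1 -[y]Z2_val_natr -(odd_double_half (val y)).
  rewrite natrD -muln2 natrM mulrDr mulrCA -exprSr prednK // Z2_exp2e mulr0.
  by rewrite addr0 !inE; case: odd; rewrite ?mulr1 ?mulr0 eqxx ?orbT.
rewrite !inE => /orP[] /eqP->; first by rewrite mulr0.
by rewrite -exprS prednK ?Z2_exp2e.
Qed.

Lemma Z2_parity x : (exists y, x = 2 * y) \/ (exists y, x = 1 + 2 * y).
Proof.
rewrite -[x]Z2_val_natr -(odd_double_half (val x)) -muln2 natrD natrM mulrC.
by case: odd; [right|left]; exists (val x)./2%:R; rewrite ?add0r.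
Qed.

Lemma Z2_odd_neq_even x y : 1 + 2 * x != 2 * y.
Proof.
apply/eqP => E; have /eqP : (2 : Z) ^+ e.-1 = 0.
  have h : (2 : Z) * 2 ^+ e.-1 = 0 by rewrite -exprS prednK ?Z2_exp2e // (leq_trans _ e_ge2).
  have -> : (2 : Z) ^+ e.-1 = 2 ^+ e.-1 * (1 + 2 * x) - x * (2 * 2 ^+ e.-1) by ring.
  by rewrite E h; ring: h.
by rewrite Z2_exp2_eq0 leqNgt prednK ?leqnn // (leq_trans _ e_ge2).
Qed.

Lemma Z2_odd_unit y : 1 + 2 * y \is a GRing.unit.
Proof.
rewrite -[y]Z2_val_natr -natrM -[1]/(1%:R) -natrD unitZpE ?expe_gt1 //.
by rewrite coprimeXl // coprime2n oddD oddM.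
Qed.

Lemma Z2_unit_odd a : a \is a GRing.unit -> exists y, a = 1 + 2 * y.
Proof.
move=> Ua; case: (Z2_parity a) => // -[y Ea].
have [w Ew] : exists w, 2 * w = 1 :> Z.
  by exists (y * a^-1); rewrite mulrA -Ea divrr.
by have /eqP := Z2_odd_neq_even 0 w; rewrite Ew mulr0 addr0.
Qed.

Lemma Z2_factor x : exists k, exists2 y, (k <= e)%N & x = 2 ^+ k * (1 + 2 * y).
Proof.
have [->|x0] := eqVneq x 0.
  by exists e, 0; rewrite ?Z2_exp2e ?mul0r.
have vx_gt0 : (0 < val x)%N by rewrite lt0n -(inj_eq val_inj) in x0 *.
have [k Ok Ex] := @pfactor_coprime 2 _ isT vx_gt0.
exists (logn 2 (val x)), (k./2)%:R.
  rewrite -(leq_exp2l _ _ (ltnSn 1)) (leq_trans (dvdn_leq vx_gt0 (pfactor_dvdnn _ _))) //.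
  by have := ltn_ord x; rewrite [X in (_ < X)%N](Zp_cast expe_gt1) => /ltnW.
rewrite -[LHS]Z2_val_natr {1}Ex natrM natrX mulrC; congr (_ * _).
have Hk : k = (1 + 2 * k./2)%N.
  by rewrite -[LHS]odd_double_half -coprime2n Ok -muln2 mulnC.
by rewrite {1}Hk natrD natrM.
Qed.

Lemma Z2_odd_unitE a : (a \is a GRing.unit) <-> (exists y, a = 1 + 2 * y).
Proof. by split=> [/Z2_unit_odd|[y ->]]; last exact: Z2_odd_unit. Qed.

(** As 4 divides 2^e, the residue mod 4 makes sense in [Z]; for e = 2 the condition says a = 1. *)
Definition mod4_1 a := [exists t : Z, a == 1 + 4 * t].

Lemma mod4_1P a : reflect (exists t, a = 1 + 4 * t) (mod4_1 a).
Proof. by apply: (iffP existsP) => -[t /eqP E]; exists t => //; apply/eqP. Qed.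

Lemma mod4_3P a : a \is a GRing.unit ->
  reflect (exists t, a = 4 * t - 1) (~~ mod4_1 a).
Proof.
move=> Ua; apply: (iffP idP) => [N|[t ->]].
  have [y Ea] := Z2_unit_odd Ua; case: (Z2_parity y) => -[w Ew].
    by case/mod4_1P: N; exists w; rewrite Ea Ew; ring.
  by exists (1 + w); rewrite Ea Ew; ring.
apply/mod4_1P => -[s /eqP]; rewrite -subr_eq0 => /eqP E.
have : 2 * (1 + 2 * (s - t)) = 0 by apply: (lincomb1 (-1) E); ring.
move/eqP; rewrite Z2_annihilator_val !inE => /orP[] /eqP.
  move=> E0; have := Z2_odd_neq_even (s - t) 0; by rewrite E0 mulr0 eqxx.
have -> : e.-1 = e.-2.+1 by case: (e) e_ge2 => [|[|]].
rewrite exprS => E0.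
by have := Z2_odd_neq_even (s - t) (2 ^+ e.-2); rewrite E0 eqxx.
Qed.

Lemma mod4_1_unit a : mod4_1 a -> a \is a GRing.unit.
Proof.
case/mod4_1P => t ->; apply/Z2_odd_unitE; exists (2 * t); ring.
Qed.

Lemma mod4_1_1 : mod4_1 1.
Proof. by apply/mod4_1P; exists 0; ring. Qed.

Lemma mod4_1M a b : a \is a GRing.unit -> b \is a GRing.unit ->
  mod4_1 (a * b) = (mod4_1 a == mod4_1 b).
Proof.
move=> Ua Ub; have Uab : a * b \is a GRing.unit by rewrite unitrM Ua.
case: (boolP (mod4_1 a)) => [/mod4_1P[s ->]|/(mod4_3P Ua)[s Ea]].
  case: (boolP (mod4_1 b)) => [/mod4_1P[t ->]|/(mod4_3P Ub)[t Eb]].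
    by apply/mod4_1P; exists (s + t + 4 * s * t); ring.
  apply/negbTE; move: (Uab); rewrite -(mul1r (_ * _)) mul1r => _.
  apply/mod4_3P; last by exists (t - s + 4 * s * t); rewrite Eb; ring.
  by rewrite unitrM Ub andbT; apply/Z2_odd_unitE; exists (2 * s); ring.
case: (boolP (mod4_1 b)) => [/mod4_1P[t Eb]|/(mod4_3P Ub)[t Eb]].
  by apply/negbTE/(mod4_3P Uab); exists (s - t + 4 * s * t); rewrite Ea Eb; ring.
by apply/mod4_1P; exists (4 * s * t - s - t); rewrite Ea Eb; ring.
Qed.

(** The sum 1 + a + ... + a^(n-1), by which the first coordinate is multiplied in an n-th power. *)
Fixpoint geom a n : Z := if n is n'.+1 then 1 + a * geom a n' else 0.

Lemma geomD a m n : geom a (m + n) = geom a m + a ^+ m * geom a n.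
Proof.
elim: m => [|m IH]; first by rewrite !add0n add0r expr0 mul1r.
by rewrite addSn /= IH exprS; ring.
Qed.

Lemma expr_geom a n : a ^+ n = 1 + (a - 1) * geom a n.
Proof. by elim: n => [|n IH] /=; rewrite ?exprS ?expr0 ?IH; ring. Qed.

Lemma geom_sqr a n : geom a (n * 2) = (1 + a) * geom (a ^+ 2) n.
Proof.
elim: n => [|n IH]; first by rewrite mul0n /= mulr0.
by rewrite mulSn addnC addn2 /= IH; ring.
Qed.

(** Induction through [geom_sqr]: the factor 1 + a is twice an odd number and a^2 is again 1 mod 4,
    so each doubling of the length adds exactly one factor 2. *)
Lemma geom_mod4_1 a k : mod4_1 a -> exists t, geom a (2 ^ k) = 2 ^+ k * (1 + 2 * t).
Proof.
elim: k a => [|k IH] a Ma.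
  by exists 0; rewrite expn0 expr0 /=; ring.
have [s Ea] := mod4_1P _ Ma.
have /IH[t Et] : mod4_1 (a ^+ 2) by rewrite mod4_1M ?eqxx ?mod4_1_unit.
exists (s + t + 2 * s * t); rewrite expnSr geom_sqr Et Ea exprS; ring.
Qed.

(** Here 1 + a is divisible by 4, so the first doubling gains an extra factor 2; from then on a^2 =
    1 mod 4 takes over. *)
Lemma geom_mod4_3 a k : a \is a GRing.unit -> ~~ mod4_1 a ->
  exists t, geom a (2 ^ k.+1) = 2 ^+ k * (4 * t).
Proof.
move=> Ua Na; have [s Ea] := mod4_3P Ua Na.
have /(@geom_mod4_1 _ k)[t Et] : mod4_1 (a ^+ 2) by rewrite mod4_1M ?eqxx.
exists (s * (1 + 2 * t)); rewrite expnSr geom_sqr Et Ea; ring.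
Qed.

End TwoAdic.

Section TwoAdic2.
Local Open Scope ring_scope.
Context {e : nat} (e_ge2 : (2 <= e)%N).
Local Notation Z := 'Z_(2 ^ e).
Implicit Types a b u v x y : Z.

(** Digit by digit: if [geom a i] agrees with y mod 2^j but misses the next binary digit, adding 2^j
    to i corrects that digit. *)
Lemma geom_surj a y : mod4_1 a -> exists i, geom a i = y.
Proof.
move=> Ma; have H j : exists i w, y = geom a i + 2 ^+ j * w.
  elim: j => [|j [i [w Ew]]].
    by exists 0%N, y; rewrite expr0 /=; ring.
  case: (Z2_parity w) => -[w' Ew'].
    by exists i, w'; rewrite Ew Ew' exprS; ring.
  have [t Et] := geom_mod4_1 e_ge2 j Ma.
  have [s Es] : exists s, a ^+ i = 1 + 2 * s.
    by apply/(Z2_odd_unitE e_ge2); rewrite unitrX ?mod4_1_unit.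
  exists (i + 2 ^ j)%N, (w' - s - t - 2 * s * t).
  by rewrite geomD Et Es Ew Ew' exprS; ring.
by have [i [w Ew]] := H e; exists i; rewrite Ew Z2_exp2e // mul0r addr0.
Qed.

Lemma mod4_1_2X i y : (2 <= i)%N -> mod4_1 (1 + 2 ^+ i * y : Z).
Proof.
move=> i2; apply/mod4_1P; exists (2 ^+ (i - 2) * y).
by rewrite -{1}(subnKC i2) exprD; ring.
Qed.

Lemma pow_generator i t y : (2 <= i)%N ->
  exists k, 1 + 2 ^+ i * y = (1 + 2 ^+ i * (1 + 2 * t)) ^+ k :> Z.
Proof.
move=> i2; have Ut := Z2_odd_unit e_ge2 t.
have [k Ek] := geom_surj (y / (1 + 2 * t)) (mod4_1_2X (1 + 2 * t) i2).
exists k; rewrite [RHS]expr_geom Ek -{1}(divrK Ut y).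
by move: (y / _)%R => w; ring.
Qed.

Lemma mod4_1_factor a : mod4_1 a ->
  exists i, exists2 t, (2 <= i <= e)%N & a = 1 + 2 ^+ i * (1 + 2 * t).
Proof.
case/mod4_1P => s Ea; have [k [t le_ke Es]] := Z2_factor e_ge2 s.
have Ea' : a = 1 + 2 ^+ k.+2 * (1 + 2 * t) by rewrite Ea Es !exprS; ring.
have [le_e|lt_e] := leqP e k.+2; last first.
  by exists k.+2, t; first exact: ltnW lt_e.
(* Here a = 1, which is recorded under the exponent i = e. *)
exists e, 0; first by rewrite e_ge2 leqnn.
have /eqP Ek : (2 : Z) ^+ k.+2 == 0 by rewrite Z2_exp2_eq0.
by rewrite Ea' Ek Z2_exp2e // !mul0r.
Qed.

End TwoAdic2.

(** * The holomorph *)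

Section Holomorph.
Context {e : nat} (e_ge2 : (2 <= e)%N).
Local Notation Z := 'Z_(2 ^ e).
Implicit Types (x y g h : hol e) (u v w a b : Z) (T G H X : {group hol e}).

Definition mul_part x : Z := val x.2.
Definition mkhol u a : hol e := (u, insubd (1 : {unit Z}) a).
Local Notation r := mul_part.

Lemma mul_partU x : r x \is a GRing.unit. Proof. exact: valP x.2. Qed.
Hint Resolve mul_partU : core.

Lemma hol_eqP x y : x.1 = y.1 -> r x = r y -> x = y.
Proof. by case: x y => [u a] [v b] /= -> Ev; congr (_, _); apply: val_inj. Qed.

Lemma add_partM x y : (x * y).1 = (x.1 + y.1 * r x)%R. Proof. by []. Qed.
Lemma mul_partM x y : r (x * y) = (r x * r y)%R. Proof. by []. Qed.
Lemma add_part1 : (1 : hol e).1 = 0%R. Proof. by []. Qed.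
Lemma mul_part1 : r 1 = 1%R. Proof. by []. Qed.
Definition partsM := (add_partM, mul_partM, add_part1, mul_part1).

Lemma mul_partV x : r x^-1 = ((r x)^-1)%R.
Proof.
apply: (mulrI (mul_partU x)); rewrite [RHS](divrr (mul_partU x)).
by rewrite -(mul_partM x x^-1) mulgV.
Qed.

Lemma add_partV x : x^-1.1 = (- (x.1 / r x))%R.
Proof. by rewrite -mul_partV. Qed.

Lemma mkhol1 u a : (mkhol u a).1 = u. Proof. by []. Qed.
Lemma mkhol2 u a : a \is a GRing.unit -> r (mkhol u a) = a.
Proof. by move=> Ua; rewrite /r /mkhol /= insubdK. Qed.

Lemma add_partX x n : (x ^+ n).1 = (x.1 * geom (r x) n)%R.
Proof.
elim: n => [|n IH]; first by rewrite expg0 /= mulr0.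
by rewrite expgS add_partM IH /=; ring.
Qed.

Lemma mul_partX x n : r (x ^+ n) = (r x ^+ n)%R.
Proof. by elim: n => [|n IH] //; rewrite expgS mul_partM IH exprS. Qed.

Lemma in_holN x : (x \in holN e) = (r x == 1%R).
Proof. by rewrite inE -val_eqE. Qed.

Lemma in_hol_stab (T : {set hol e}) x : (x \in hol_stab T) = (x \in T) && (x.1 == 0%R).
Proof. by rewrite !inE. Qed.

Lemma holN_group_set : group_set (holN e).
Proof.
apply/group_setP; split=> [|x y]; first by rewrite in_holN.
by rewrite !in_holN partsM => /eqP-> /eqP->; rewrite mulr1.
Qed.
Canonical holN_group := group holN_group_set.

Lemma holAut_group_set : group_set (holAut e).
Proof.
apply/group_setP; split=> [|x y]; rewrite !inE // => /eqP x0 /eqP y0.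
by rewrite partsM x0 y0 mul0r addr0.
Qed.
Canonical holAut_group := group holAut_group_set.
Canonical hol_stab_group T := Eval hnf in [group of hol_stab T].

Lemma hol_act1 v : hol_act 1 v = v.
Proof. by rewrite /hol_act add0r mul1r. Qed.
Lemma hol_actM x y v : hol_act (x * y) v = hol_act x (hol_act y v).
Proof. by rewrite /hol_act -/(r _) -/(r _) !partsM; rewrite /r /=; ring. Qed.

(** [hol_act] is a left action while library actions are right actions, hence the inverse. *)
Lemma hol_raction_is : is_action [set: hol e] (fun v x => hol_act x^-1 v).
Proof.
split=> [x u v /(congr1 (hol_act x))|v x y _ _].
  by rewrite -!hol_actM mulgV !hol_act1.
by rewrite invMg hol_actM.
Qed.
Definition hol_raction := Action hol_raction_is.

Lemma orbit0E T v : (v \in orbit hol_raction T 0%R) = [exists g in T, g.1 == v].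
Proof.
apply/orbitP/exists_inP => -[g Tg].
  by move=> <-; exists g^-1; rewrite ?groupV //= /hol_act mulr0 addr0.
by move/eqP<-; exists g^-1; rewrite ?groupV //= invgK /hol_act mulr0 addr0.
Qed.

Lemma astab0E T : 'C_T[0%R | hol_raction] = hol_stab T.
Proof.
apply/setP=> x; rewrite in_hol_stab inE; case Tx: (x \in T) => //=.
apply/astab1P/eqP => /=; rewrite /hol_act mulr0 addr0 add_partV.
  move/eqP; rewrite oppr_eq0 -{2}[x.1](divrK (mul_partU x)) => /eqP->.
  by rewrite mul0r.
by move->; rewrite mul0r oppr0.
Qed.

Lemma transitive_add_part T :
  hol_transitive T <-> forall v, exists2 g, g \in T & g.1 = v.
Proof.
split=> trT v => [|w].
  by have [g Tg Eg] := trT 0%R v; exists g; rewrite // -Eg /hol_act mulr0 addr0.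
have [g Tg Eg] := trT v; have [k Tk Ek] := trT w.
have act0 (x : hol e) : hol_act x 0%R = x.1 by rewrite /hol_act mulr0 addr0.
exists (k * g^-1); first by rewrite groupM ?groupV.
by rewrite -Eg -Ek -!act0 -hol_actM mulgKV.
Qed.

Lemma card_Z2 : #|{: Z}| = (2 ^ e)%N.
Proof. by rewrite card_ord (Zp_cast (expe_gt1 e_ge2)). Qed.

Lemma transitive_index T : hol_transitive T <-> #|T : hol_stab T| = (2 ^ e)%N.
Proof.
have HI : #|orbit hol_raction T 0%R| = #|T : hol_stab T|.
  by rewrite card_orbit ?subsetT ?astab0E.
rewrite transitive_add_part -HI; have cZ := card_Z2; split=> [trT|cT v].
  rewrite -[RHS]cZ; apply: eq_card => v; rewrite orbit0E inE; apply/exists_inP.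
  by have [g Tg Eg] := trT v; exists g; rewrite ?Eg.
have : v \in orbit hol_raction T 0%R.
  suff -> : orbit hol_raction T 0%R = [set: Z] by rewrite inE.
  by apply/eqP; rewrite eqEcard subsetT cardsT cT [X in (X <= _)%N]cZ leqnn.
by rewrite orbit0E => /exists_inP[g Tg /eqP]; exists g.
Qed.

End Holomorph.
#[local] Hint Resolve mul_partU : core.

Section Translations.
Context {e : nat} (e_ge2 : (2 <= e)%N).
Local Notation Z := 'Z_(2 ^ e).
Implicit Types (x y g h : hol e) (u v w a b : Z) (T G H X : {group hol e}).
Local Notation r := mul_part.

(* The element sigma^u of N. *)
Definition transl u : hol e := mkhol u 1%R.

Lemma transl1 u : (transl u).1 = u. Proof. by []. Qed.
Lemma mul_part_transl u : r (transl u) = 1%R.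
Proof. by rewrite mkhol2 ?unitr1. Qed.

Lemma transl_eq x : r x = 1%R -> x = transl x.1.
Proof. by move=> Ex; apply: hol_eqP; rewrite ?mul_part_transl. Qed.

Lemma translX u n : transl u ^+ n = transl (u * n%:R)%R.
Proof.
have geom1 : geom (1 : Z)%R n = (n%:R)%R.
  by elim: n => [|n IH] //=; rewrite IH mul1r mulrS.
apply: hol_eqP; first by rewrite add_partX mul_part_transl geom1.
by rewrite mul_partX !mul_part_transl expr1n.
Qed.

Lemma transl_in_holN u : transl u \in holN e.
Proof. by rewrite in_holN mul_part_transl. Qed.

Lemma order_transl k : (k <= e)%N -> #[transl (2 ^+ k)%R] = (2 ^ (e - k))%N.
Proof.
move=> le_ke; apply/eqP; rewrite eqn_dvd.
have D n : (#[transl (2 ^+ k)%R] %| n) = (2 ^ (e - k) %| n).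
  rewrite order_dvdn translX -natrX -natrM.
  have -> : (transl (2 ^ k * n)%:R%R == 1) = ((2 ^ k * n)%:R == 0 :> Z)%R.
    apply/eqP/eqP => [/(congr1 fst) //|->].
    by apply: hol_eqP; rewrite ?mul_part_transl.
  by rewrite Z2_natr_eq0 // -{1}(subnKC le_ke) expnD dvdn_pmul2l ?expn_gt0.
by rewrite D dvdnn -D dvdnn.
Qed.

Lemma holN_cycle : holN e = <[transl 1%R]>.
Proof.
apply/eqP; rewrite eqEsubset cycle_subG transl_in_holN andbT.
apply/subsetP => x; rewrite in_holN => /eqP/transl_eq->.
by apply/cycleP; exists (val x.1); rewrite translX mul1r Z2_val_natr.
Qed.

Lemma card_holN : #|holN e| = (2 ^ e)%N.
Proof. by rewrite holN_cycle -orderE -(expr0 2%R) order_transl ?subn0. Qed.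

Lemma card_meet_holN X : exists2 k, (k <= e)%N & #|X :&: holN e| = (2 ^ k)%N.
Proof.
by apply/dvdn_pfactor => //; rewrite -card_holN cardSg ?subsetIr.
Qed.

Lemma transl_sub X k u : (k <= e)%N -> (2 ^ k <= #|X :&: holN e|)%N ->
  transl (2 ^+ (e - k) * u)%R \in X.
Proof.
move=> le_ke le_kX; have [i le_ie Ei] := card_meet_holN X.
have : <[transl (2 ^+ (e - k))%R]> \subset X :&: holN e.
  rewrite -(@cardSg_cyclic _ (holN_group)) ?subsetIr ?cycle_subG ?transl_in_holN //=.
    rewrite -orderE order_transl ?leq_subr // subKn // Ei dvdn_Pexp2l //.
    by rewrite -(@leq_exp2l 2) // -Ei.
  by rewrite holN_cycle cycle_cyclic.
rewrite subsetI cycle_subG => /andP[Xs _].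
by rewrite -[u]Z2_val_natr -translX groupX.
Qed.

Lemma meet_holN_trivial X x : #|X :&: holN e| = 1%N -> x \in X -> r x = 1%R -> x = 1.
Proof.
move=> c1 Xx Rx; have E : X :&: holN e = 1.
  exact: (@card1_trivg _ (X :&: holN_group)).
have : x \in X :&: holN e by rewrite inE Xx in_holN Rx /=.
by rewrite E => /set1P.
Qed.

Lemma meet_holN_card2 X x : #|X :&: holN e| = 2%N -> x \in X -> r x = 1%R ->
  (2 * x.1 = 0)%R.
Proof.
move=> c2 Xx Rx; have : x ^+ 2 = 1.
  apply/eqP; rewrite -order_dvdn -c2 (@order_dvdG _ (X :&: holN_group)) //.
  by rewrite inE Xx in_holN Rx /=.
move/(congr1 fst); rewrite expgS expg1 add_partM Rx mulr1 add_part1 => E.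
by rewrite -[RHS]E; ring.
Qed.

Lemma half_transl_in X u : (2 <= #|X :&: holN e|)%N -> (2 * u = 0)%R -> transl u \in X.
Proof.
move=> c2 u2; have e_gt0 : (0 < e)%N by apply: leq_trans e_ge2.
have [t ->] : exists t : Z, u = (2 ^+ (e - 1) * t)%R.
  by apply: Z2_annihilator => //; rewrite expr1.
by apply: transl_sub.
Qed.

End Translations.

(** * Homomorphisms to Hol(N) in place of isomorphisms of the quotient *)

Section Model.
Context {e : nat} (e_ge2 : (2 <= e)%N).
Local Notation Z := 'Z_(2 ^ e).
Implicit Types (x y g h : hol e) (u v w a b : Z) (T G H X : {group hol e}) (p : hol e -> hol e).
Local Notation r := mul_part.

(** The two coordinates of p are the crossed homomorphism and its character. A total function avoids
    carrying quotients and morphism structures; only its values on G matter. *)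
Definition perm_model G H (p : hol e -> hol e) :=
  {in G &, {morph p : x y / x * y}} /\
  (forall x, x \in G -> ((p x).1 == 0%R) = (x \in H)).

Lemma index_morphim_ker (rT : finGroupType) G H (f : {morphism G >-> rT}) :
  'ker f \subset H -> H \subset G -> #|f @* G : f @* H| = #|G : H|.
Proof.
move=> sKH sHG.
have HG : #|f @* G| = #|G : 'ker f| by rewrite card_morphim setIid.
have HH : #|f @* H| = #|H : 'ker f| by rewrite card_morphim (setIidPr sHG).
apply/eqP; rewrite -(@eqn_pmul2r #|f @* H|) ?cardG_gt0 // mulnC Lagrange ?morphimS //.
by rewrite HG HH Lagrange_index.
Qed.

Lemma perm_model_stab G H p (pM : {in G &, {morph p : x y / x * y}}) : H \subset G ->
  (forall x, x \in G -> ((p x).1 == 0%R) = (x \in H)) ->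
  let f := Morphism pM in 'ker f \subset H /\ f @* H = hol_stab (f @* G).
Proof.
move=> sHG pH f; split.
  by apply/subsetP=> x kx; have Gx := dom_ker kx; rewrite -pH // [p x](mker kx).
apply/setP => t; rewrite in_hol_stab; apply/idP/andP.
  case/morphimP => x Gx Hx ->; rewrite mem_morphim //; split=> //=.
  by rewrite pH.
case=> /morphimP[x _ Gx ->] x0; apply: mem_morphim => //.
by rewrite -pH.
Qed.

Lemma perm_model_trans G H p : H \subset G -> #|G : H| = (2 ^ e)%N ->
  perm_model G H p -> forall v, exists2 x, x \in G & (p x).1 = v.
Proof.
move=> sHG iHG [pM pH] v; have [sKH fH] := perm_model_stab pM sHG pH.
have : hol_transitive (Morphism pM @* G).
  by apply/(transitive_index e_ge2 (Morphism pM @* G)); rewrite -fH index_morphim_ker.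
move/(transitive_add_part (Morphism pM @* G))/(_ v) => [_ /morphimP[x _ Gx ->] <-].
by exists x.
Qed.

(** The point stabiliser of a transitive image pulls back to a subgroup of index 2^e. It contains H,
    so by counting it is H: vanishing on H suffices. *)
Lemma perm_model_of_trans G H p : H \subset G -> #|G : H| = (2 ^ e)%N ->
  {in G &, {morph p : x y / x * y}} -> (forall h, h \in H -> (p h).1 = 0%R) ->
  (forall v, exists2 x, x \in G & (p x).1 = v) -> perm_model G H p.
Proof.
move=> sHG iHG pM pH0 trp; split=> //; pose f := Morphism pM.
pose K := (f @*^-1 (holAut_group : {group hol e}))%G.
have sKG : K \subset G by apply: subsetIl.
have KP x : x \in G -> ((p x).1 == 0%R) = (x \in K) by move=> Gx; rewrite !inE Gx.
have [skK fK] := perm_model_stab pM sKG KP.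
have trT : hol_transitive (f @* G).
  apply/(transitive_add_part (f @* G)) => v; have [x Gx Ex] := trp v.
  by exists (f x) => //; apply: mem_morphim.
have iK : #|G : K| = (2 ^ e)%N.
  rewrite -(index_morphim_ker skK sKG) fK.
  exact/(transitive_index e_ge2 (f @* G)).
suff EHK : H :=: K by move=> x Gx; rewrite EHK KP.
apply/eqP; rewrite eqEcard; apply/andP; split.
  by apply/subsetP => h Hh; rewrite -KP ?pH0 ?eqxx // (subsetP sHG).
by rewrite -(@leq_pmul2r (2 ^ e)) ?expn_gt0 // -{1}iK -iHG !Lagrange.
Qed.

Lemma perm_modelJ G H y p :
  perm_model (G :^ y) (H :^ y) p -> perm_model G H (fun x => p (x ^ y)).
Proof.
case=> pM pH; split=> [a b Ga Gb|x Gx]; first by rewrite conjMg pM ?memJ_conjg.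
by rewrite pH memJ_conjg.
Qed.

(** An element of the core has all its conjugates in the stabiliser of 0, so by transitivity its
    image fixes every point; fixing 0 and 1 already forces the identity of Hol(N). *)
Lemma gcore_ker G H (f : {morphism G >-> hol e}) :
  H \subset G -> (forall x, x \in G -> ((f x).1 == 0%R) = (x \in H)) ->
  hol_transitive (f @* G) -> 'ker f = gcore H G.
Proof.
move=> sHG pH trp; apply/eqP; rewrite eqEsubset; apply/andP; split.
  rewrite sub_gcore ?normal_norm ?ker_normal //.
  apply/subsetP=> x kx; have Gx := dom_ker kx.
  by rewrite -pH // (mker kx) add_part1.
apply/subsetP => x Cx; have Hx := subsetP (gcore_sub _ _) x Cx.
have Gx := subsetP sHG x Hx; apply/kerP => //.
have fixp v : hol_act (f x) v = v.
  have /transitive_add_part/(_ v)[_ /morphimP[y _ Gy ->] Ev] := trp.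
  have Hxy : x ^ y \in H.
    apply: (subsetP (gcore_sub H G)).
    by rewrite memJ_norm // (subsetP (gcore_norm H G)).
  have := pH _ (subsetP sHG _ Hxy); rewrite Hxy => /eqP.
  have -> : x ^ y = y^-1 * (x * y) by rewrite /conjg mulgA.
  rewrite !morphM ?morphV ?groupM ?groupV // => E.
  have : (f y * ((f y)^-1 * (f x * f y))).1 = (f y).1.
    by rewrite partsM E mul0r addr0.
  by rewrite mulKVg partsM Ev /hol_act mulrC.
apply: hol_eqP; first by have := fixp 0%R; rewrite /hol_act mulr0 addr0.
have := fixp 1%R; have := fixp 0%R; rewrite /hol_act !mulr0 !addr0 => ->.
by rewrite add0r mulr1.
Qed.

Lemma perm_modelP G H : H \subset G -> #|G : H| = (2 ^ e)%N ->
  (exists (T : {group hol e}) (f : {morphism (G / gcore H G) >-> hol e}),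
      [/\ hol_transitive T, isom (G / gcore H G) T f
        & f @* (H / gcore H G) = hol_stab T])
  <-> exists p, perm_model G H p.
Proof.
move=> sHG iHG; have nCG := gcore_norm H G; have sCH := gcore_sub H G.
split=> [[T [f [trT /isomP[injf fT] fH]]]|[p modp]].
  have Gq x : x \in G -> coset (gcore H G) x \in G / gcore H G.
    by move=> Gx; rewrite mem_quotient.
  exists (fun x => f (coset (gcore H G) x)); split=> [x y Gx Gy|x Gx].
    rewrite morphM ?(subsetP nCG) // morphM //; exact: Gq.
  have -> : ((f (coset (gcore H G) x)).1 == 0%R)
      = (f (coset (gcore H G) x) \in hol_stab T).
    by rewrite in_hol_stab -fT mem_morphim ?Gq.
  rewrite -fH; apply/idP/idP => [|Hx]; last first.
    by rewrite mem_morphim ?Gq // mem_quotient.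
  case/morphimP => xb Gh /morphimP[h Nh Hh Exb]; rewrite {}Exb in Gh *.
  move/(injmP injf) => Exh.
  have [z Cz Ez] := kercoset_rcoset (subsetP nCG _ Gx) Nh (Exh (Gq _ Gx) Gh).
  by rewrite Ez groupM // (subsetP sCH).
have [pM pH] := modp; have [sKH fH] := perm_model_stab pM sHG pH.
pose rho := Morphism pM.
have trT : hol_transitive (rho @* G).
  apply/(transitive_add_part (rho @* G)) => v.
  have [x Gx Ex] := perm_model_trans sHG iHG modp v.
  by exists (rho x) => //; apply: mem_morphim.
rewrite -(gcore_ker (f := rho) sHG pH trT).
have [f injf fE] := first_isom rho.
exists (rho @* G)%G, f; split=> //; last by rewrite fE fH.
by apply/isomP; rewrite fE.
Qed.

Lemma perm_model_ker G H p k : H \subset G -> #|G : H| = (2 ^ e)%N ->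
  perm_model G H p -> k \in G -> (forall y, y \in G -> k ^ y \in H) -> p k = 1.
Proof.
move=> sHG iHG modp Gk kH; have [pM pH] := modp.
have trT : hol_transitive (Morphism pM @* G).
  apply/(transitive_add_part (Morphism pM @* G)) => v.
  have [x Gx Ex] := perm_model_trans sHG iHG modp v.
  by exists (p x) => //; apply: (mem_morphim (Morphism pM)).
have : k \in gcore H G.
  apply/bigcapP => y Gy; rewrite mem_conjg.
  by rewrite kH // groupV.
by rewrite -(gcore_ker (f := Morphism pM) sHG pH trT) => /mker.
Qed.
End Model.

(** * Powers, elements of order 2^e, commutators *)

Section Types.
Context {e : nat} (e_ge2 : (2 <= e)%N).
Local Notation Z := 'Z_(2 ^ e).
Implicit Types (x y g h : hol e) (u v w a b : Z) (T G H X : {group hol e}) (p : hol e -> hol e).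
Local Notation r := mul_part.

Lemma Z2_unitE u : (u \is a GRing.unit) = ~~ [exists t, u == 2%R * t]%R.
Proof.
apply/idP/negP => [/(Z2_unit_odd e_ge2)[y ->] /existsP[t /eqP E]|N].
  by have := Z2_odd_neq_even e_ge2 y t; rewrite E eqxx.
case: (Z2_parity u) => -[t Et]; first by case: N; apply/existsP; exists t; rewrite Et.
by apply/(Z2_odd_unitE e_ge2); exists t.
Qed.

Lemma Z2_even u : u \isn't a GRing.unit -> exists t, u = (2 * t)%R.
Proof. by rewrite Z2_unitE negbK => /existsP[t /eqP]; exists t. Qed.

Lemma Z2_2N u : (2 * u)%R \isn't a GRing.unit.
Proof. by rewrite Z2_unitE negbK; apply/existsP; exists u. Qed.

Lemma Z2_unitD2 u v : (u + 2 * v \is a GRing.unit)%R = (u \is a GRing.unit).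
Proof.
rewrite !Z2_unitE; congr (~~ _); apply/existsP/existsP => -[t /eqP E].
  by exists (t - v)%R; apply/eqP; apply: (lincomb1 1%R E); ring.
by exists (t + v)%R; apply/eqP; rewrite E; ring.
Qed.

Lemma Z2_exp2_odd k t : (k < e)%N -> (2 ^+ k * (1 + 2 * t) != 0 :> Z)%R.
Proof.
move=> lt_ke; apply/eqP => E; have /eqP : (2 ^+ k = 0 :> Z)%R.
  by apply: (mulIr (Z2_odd_unit e_ge2 t)); rewrite E mul0r.
by rewrite Z2_exp2_eq0 // leqNgt lt_ke.
Qed.

Lemma Z2_exp2_ge k : (e <= k)%N -> (2 ^+ k = 0 :> Z)%R.
Proof. by move=> le_ek; apply/eqP; rewrite Z2_exp2_eq0. Qed.

Lemma hol_pow_mod4_1 x k : mod4_1 (r x) -> exists t,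
  (x ^+ (2 ^ k)).1 = (2 ^+ k * (1 + 2 * t) * x.1)%R /\
  r (x ^+ (2 ^ k)) = (1 + (r x - 1) * (2 ^+ k * (1 + 2 * t)))%R.
Proof.
move=> Mx; have [t Et] := geom_mod4_1 e_ge2 k Mx; exists t.
split; first by rewrite add_partX Et mulrC.
by rewrite mul_partX [LHS]expr_geom Et.
Qed.

Lemma hol_pow_mod4_3 x k : ~~ mod4_1 (r x) -> exists t s,
  (x ^+ (2 ^ k.+1)).1 = (2 ^+ k * (4 * t))%R /\
  r (x ^+ (2 ^ k.+1)) = (1 + 2 ^+ k * (8 * s))%R.
Proof.
move=> Nx; have [t Et] := geom_mod4_3 e_ge2 k (mul_partU x) Nx.
have [q Eq] := mod4_3P e_ge2 (mul_partU x) Nx.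
exists (t * x.1)%R, (t * (2 * q - 1))%R.
split; first by rewrite add_partX Et; ring.
by rewrite mul_partX [LHS]expr_geom Et Eq; ring.
Qed.

Lemma hol_pow_eN1 x : r (x ^+ (2 ^ e.-1)) = 1%R /\ (2 * (x ^+ (2 ^ e.-1))%g.1 = 0)%R.
Proof.
have Ee : e.-1 = e.-2.+1 by case: (e) e_ge2 => [|[|]].
have z4 : (2 ^+ e.-2 * 4 = 0 :> Z)%R.
  have -> : (4 = 2 ^+ 2 :> Z)%R by ring.
  by rewrite -exprD Z2_exp2_ge //; nlia.
have z2 : (2 ^+ e.-1 * 2 = 0 :> Z)%R by rewrite -exprSr Z2_exp2_ge //; nlia.
case: (boolP (mod4_1 (r x))) => [Mx|Nx].
  have [t [-> ->]] := hol_pow_mod4_1 e.-1 Mx.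
  have [s Es] := mod4_1P _ Mx; rewrite Es; split.
    by apply: (lincomb1 (2 * s * (1 + 2 * t))%R z2); ring.
  by apply: (lincomb1 (x.1 * (1 + 2 * t))%R z2); ring.
rewrite Ee; have [t [s [-> ->]]] := hol_pow_mod4_3 e.-2 Nx; split.
  by apply: (lincomb1 (2 * s)%R z4); ring.
by apply: (lincomb1 (2 * t)%R z4); ring.
Qed.

(** These are the elements of order 2^e ([order_regularP]); their powers take 0 to every point
    ([regular_powers]). *)
Definition regular_elt x := (x.1 \is a GRing.unit) && mod4_1 (r x).

Lemma hol_pow_eN1_nonregular x : ~~ regular_elt x -> x ^+ (2 ^ e.-1) = 1.
Proof.
move=> Nx; have [Ex _] := hol_pow_eN1 x; apply: hol_eqP; rewrite ?Ex //.
have Ee : e.-1 = e.-2.+1 by case: (e) e_ge2 => [|[|]].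
move: Nx; rewrite negb_and; case: (boolP (mod4_1 (r x))) => [Mx|Nx _].
  rewrite orbF => /Z2_even[s Es]; have [t [-> _]] := hol_pow_mod4_1 e.-1 Mx.
  have z2 : (2 ^+ e.-1 * 2 = 0 :> Z)%R by rewrite -exprSr Z2_exp2_ge //; nlia.
  by rewrite Es add_part1; apply: (lincomb1 (s * (1 + 2 * t))%R z2); ring.
rewrite Ee; have [t [s [-> _]]] := hol_pow_mod4_3 e.-2 Nx.
have z4 : (2 ^+ e.-2 * 4 = 0 :> Z)%R.
  have -> : (4 = 2 ^+ 2 :> Z)%R by ring.
  by rewrite -exprD Z2_exp2_ge //; nlia.
by rewrite add_part1; apply: (lincomb1 t z4); ring.
Qed.

(** For e = 2 the exponent is 1 and x need not be a translation, so the obstructions that use this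
    treat e = 2 apart. *)
Lemma hol_pow_eN2 x : (3 <= e)%N ->
  [/\ r (x ^+ (2 ^ e.-2)) = 1%R,
      exists t, (x ^+ (2 ^ e.-2)).1 = (2 ^+ e.-2 * t)%R
    & ~~ regular_elt x -> (2 * (x ^+ (2 ^ e.-2))%g.1 = 0)%R].
Proof.
move=> e_ge3.
have Ee : e.-2 = (e - 3).+1 by nlia.
have z4 : (2 ^+ e.-2 * 4 = 0 :> Z)%R.
  have -> : (4 = 2 ^+ 2 :> Z)%R by ring.
  by rewrite -exprD Z2_exp2_ge //; nlia.
have z8 : (2 ^+ (e - 3) * 8 = 0 :> Z)%R.
  have -> : (8 = 2 ^+ 3 :> Z)%R by ring.
  by rewrite -exprD Z2_exp2_ge //; nlia.
rewrite /regular_elt negb_and; case: (boolP (mod4_1 (r x))) => [Mx|Nx].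
  have [t [-> ->]] := hol_pow_mod4_1 e.-2 Mx.
  have [s Es] := mod4_1P _ Mx; rewrite Es; split.
  - by apply: (lincomb1 (s * (1 + 2 * t))%R z4); ring.
  - by exists ((1 + 2 * t) * x.1)%R; ring.
  rewrite orbF => /Z2_even[q ->].
  by apply: (lincomb1 (q * (1 + 2 * t))%R z4); ring.
rewrite Ee; have [t [s [-> ->]]] := hol_pow_mod4_3 (e - 3) Nx; split.
- by apply: (lincomb1 s z8); ring.
- by exists (2 * t)%R; rewrite exprS; ring.
by move=> _; apply: (lincomb1 t z8); ring.
Qed.

Lemma hol_pow_regular x k : (k < e)%N -> regular_elt x -> (x ^+ (2 ^ k)).1 != 0%R.
Proof.
move=> lt_ke /andP[Ux Mx]; have [t [-> _]] := hol_pow_mod4_1 k Mx.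
have [y ->] := Z2_unit_odd e_ge2 Ux.
have -> : (2 ^+ k * (1 + 2 * t) * (1 + 2 * y) =
           2 ^+ k * (1 + 2 * (t + y + 2 * t * y)) :> Z)%R by ring.
exact: Z2_exp2_odd.
Qed.

Lemma regular_powers x u : regular_elt x -> exists i, (x ^+ i).1 = u.
Proof.
move=> /andP[Ux Mx]; have [i Ei] := geom_surj e_ge2 (u / x.1)%R Mx.
by exists i; rewrite add_partX Ei mulrC divrK.
Qed.

(** Without regular elements, an odd first coordinate forces 3 mod 4. Conversely, multiply an
    element with even first coordinate by one over 1: the product is odd again, so both it and the
    multiplier are 3 mod 4, which leaves 1 mod 4 for the element. *)
Lemma transitive_cases T : hol_transitive T ->
  (exists2 x, x \in T & regular_elt x) \/
  (forall x, x \in T -> (x.1 \is a GRing.unit) = ~~ mod4_1 (r x)).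
Proof.
move=> trT; case: (boolP [exists x in T, regular_elt x]) => [/exists_inP|N].
  by move=> [x]; left; exists x.
right=> x Tx; have Nreg y : y \in T -> y.1 \is a GRing.unit -> ~~ mod4_1 (r y).
  move=> Ty Uy; apply: contra N => My; apply/exists_inP; exists y => //.
  exact/andP.
case: (boolP (x.1 \is a GRing.unit)) => [/(Nreg x Tx) ->//|Nx].
apply/esym/negbF; have [g Tg Eg] : exists2 g, g \in T & g.1 = 1%R.
  by have /(transitive_add_part T)/(_ 1%R) := trT.
have Ng : ~~ mod4_1 (r g) by apply: Nreg; rewrite // Eg unitr1.
have [s Es] := Z2_even Nx.
have : ~~ mod4_1 (r (g * x)).
  apply: Nreg; first exact: groupM.
  by rewrite partsM Eg Es -mulrA Z2_unitD2 unitr1.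
by rewrite partsM mod4_1M // (negbTE Ng); case: mod4_1.
Qed.

(** A regular element works; if there is none, an element over 2 is 1 mod 4, and its power has first
    coordinate 2^(e-1). *)
Lemma transitive_pow T : hol_transitive T ->
  exists2 t, t \in T & (t ^+ (2 ^ e.-2)).1 != 0%R.
Proof.
move=> trT; case: (transitive_cases trT) => [[t Tt Rt]|T2].
  by exists t => //; apply: hol_pow_regular => //; nlia.
have /(transitive_add_part T)/(_ 2%R)[t Tt Et] := trT.
have := T2 t Tt; rewrite Et -{1}[2%R]mulr1 (negbTE (Z2_2N _)) => /esym/negbFE Mt.
exists t => //; have [q [-> _]] := hol_pow_mod4_1 e.-2 Mt; rewrite Et.
have -> : (2 ^+ e.-2 * (1 + 2 * q) * 2 = 2 ^+ e.-2.+1 * (1 + 2 * q) :> Z)%R.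
  by rewrite exprS; ring.
by apply: Z2_exp2_odd; nlia.
Qed.

Lemma card_hol : #|{: hol e}| = (2 ^ (e + e.-1))%N.
Proof.
rewrite card_prod (card_Z2 e_ge2) expnD; congr (_ * _)%N.
have := @card_units_Zp (2 ^ e) (expn_gt0 2 e).
rewrite totient_pfactor // ?mul1n; last by nlia.
by move=> <-; rewrite cardsT.
Qed.

(** This is [[~ x^-1, y^-1]], chosen because its first coordinate involves no inverses. *)
Definition cmg x y := (x * y) * (y * x)^-1.

Lemma mul_part_cmg x y : r (cmg x y) = 1%R.
Proof. by rewrite !partsM mul_partV !partsM [(r y * _)%R]mulrC divrr // unitrM !mul_partU. Qed.

Lemma add_part_cmg x y :
  (cmg x y).1 = (x.1 * (1 - r y) - y.1 * (1 - r x))%R.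
Proof.
have E : cmg x y * (y * x) = x * y by rewrite mulgKV.
have := congr1 fst E.
rewrite (add_partM (cmg x y)) mul_part_cmg (add_partM y) (add_partM x) => {}E.
by apply: (lincomb1 1%R E); ring.
Qed.

Lemma in_cmg G x y : x \in G -> y \in G -> cmg x y \in G.
Proof. by move=> Gx Gy; rewrite !groupM ?groupV ?groupM. Qed.

Lemma morph_cmg G p x y : {in G &, {morph p : x y / x * y}} ->
  x \in G -> y \in G -> p (cmg x y) = cmg (p x) (p y).
Proof.
move=> pM Gx Gy; have := morphV (Morphism pM); rewrite /= => pV.
by rewrite /cmg !(pM, pV) ?groupV ?groupM.
Qed.

Lemma morph_pow G p x n : {in G &, {morph p : x y / x * y}} ->
  x \in G -> p (x ^+ n) = p x ^+ n.
Proof. by move=> pM Gx; exact: (morphX (Morphism pM)). Qed.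

(** The subgroup of order 2 of N is normal in Hol(N), and X contains it. *)
Lemma half_conj X x y : (2 <= #|X :&: holN e|)%N -> r x = 1%R -> (2 * x.1 = 0)%R ->
  x ^ y \in X.
Proof.
move=> c2 Rx x2; have Rxy : r (x ^ y) = 1%R.
  by rewrite !partsM mul_partV Rx mul1r (mulVr (mul_partU y)).
rewrite (transl_eq Rxy); apply: half_transl_in => //.
have := congr1 fst (conjgC x y); rewrite (add_partM x) (add_partM y) Rx mulr1 => E.
apply: (mulIr (mul_partU y)); rewrite mul0r -mulrA.
by apply: (lincomb2 (- 2)%R 1%R E x2); ring.
Qed.

Lemma perm_model_transitive G H p (pM : {in G &, {morph p : x y / x * y}}) :
  H \subset G -> #|G : H| = (2 ^ e)%N -> perm_model G H p ->
  hol_transitive (Morphism pM @* G).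
Proof.
move=> sHG iHG modp; apply/(transitive_add_part (Morphism pM @* G)) => v.
have [x Gx Ex] := perm_model_trans e_ge2 sHG iHG modp v.
by exists (p x) => //; apply: (mem_morphim (Morphism pM)).
Qed.

End Types.

(** * Obstructions *)

Section NoModel.
Context {e : nat} (e_ge2 : (2 <= e)%N).
Local Notation Z := 'Z_(2 ^ e).
Implicit Types (x y g h : hol e) (u v w a b : Z) (T G H X : {group hol e}) (p : hol e -> hol e).
Local Notation r := mul_part.

(** Hol(N) has order 8 when e = 2, while |G| = 4|H| is at least 8. *)
Lemma card_hol4 G H : e = 2 -> H \subset G -> #|G : H| = (2 ^ e)%N ->
  (2 <= #|H :&: holN e|)%N -> #|H| = 2 /\ G :=: [set: hol e].
Proof.
move=> e2 sHG iHG c2.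
have E4 : (2 ^ e = 4)%N by rewrite e2.
have E8 : (2 ^ (e + e.-1) = 8)%N by rewrite e2.
have cG : #|G| = (#|H| * 4)%N by rewrite -(Lagrange sHG); congr (_ * _)%N; rewrite iHG.
have c8 : #|[set: hol e]| = 8 by rewrite cardsT card_hol.
have leG := subset_leq_card (subsetT G); rewrite c8 in leG.
have leH : (2 <= #|H|)%N by rewrite (leq_trans c2) // subset_leq_card // subsetIl.
split; first nlia.
by apply/eqP; rewrite eqEcard subsetT c8; nlia.
Qed.

Lemma perm_model_pow G H p : H \subset G -> #|G : H| = (2 ^ e)%N ->
  perm_model G H p -> exists2 x, x \in G & x ^+ (2 ^ e.-2) \notin H.
Proof.
move=> sHG iHG modp; have [pM pH] := modp.
have trT := perm_model_transitive e_ge2 pM sHG iHG modp.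
have [_ /morphimP[x _ Gx ->] Ex] := transitive_pow e_ge2 trT.
by exists x => //; rewrite -pH ?groupX // (morph_pow _ pM).
Qed.

(** Every 2^(e-2)-th power in G is a translation by a multiple of 2^(e-2), and H contains all of
    these, against [perm_model_pow]. *)
Lemma no_model_card4 G H p : H \subset G -> #|G : H| = (2 ^ e)%N ->
  (4 <= #|H :&: holN e|)%N -> ~ perm_model G H p.
Proof.
move=> sHG iHG c4 modp.
have [e2|e_ge3] : e = 2 \/ (3 <= e)%N by nlia.
  have [|cH _] := @card_hol4 G H e2 sHG iHG; first nlia.
  by have := subset_leq_card (subsetIl H (holN e)); nlia.
have [x Gx /negP[]] := perm_model_pow sHG iHG modp.
have [Rx [t Et] _] := hol_pow_eN2 e_ge2 x e_ge3.
rewrite (transl_eq Rx) Et -subn2; apply: (transl_sub e_ge2 (k := 2)) => //.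
Qed.

Lemma hol_pow_e x : x ^+ (2 ^ e) = 1.
Proof.
have [R1 x2] := hol_pow_eN1 e_ge2 x.
have : x ^+ (2 ^ e.-1 * 2) = 1.
  rewrite expgM; apply: hol_eqP; last by rewrite mul_partX R1 expr1n.
  by rewrite expgS expg1 add_partM R1 mulr1 add_part1 -[RHS]x2; ring.
by rewrite -expnSr prednK //; nlia.
Qed.

Lemma order_regularP x : #[x] = (2 ^ e)%N <-> regular_elt x.
Proof.
split=> [Ox|Rx].
  case: (boolP (regular_elt x)) => // /(hol_pow_eN1_nonregular e_ge2)/eqP.
  by rewrite -order_dvdn Ox dvdn_Pexp2l //; nlia.
have : #[x] %| 2 ^ e by rewrite order_dvdn hol_pow_e.
case/(dvdn_pfactor _ _ (isT : prime 2)) => i le_ie Oi; rewrite Oi.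
have [lt_ie|le_ei] := ltnP i e; last by congr (_ ^ _)%N; nlia.
have := hol_pow_regular e_ge2 lt_ie Rx.
by rewrite -Oi expg_order add_part1 eqxx.
Qed.

Lemma no_model_no_regular G H p : H \subset G -> #|G : H| = (2 ^ e)%N ->
  (2 <= #|H :&: holN e|)%N -> (forall x, x \in G -> ~~ regular_elt x) ->
  ~ perm_model G H p.
Proof.
move=> sHG iHG c2 NG modp.
have [e2|e_ge3] : e = 2 \/ (3 <= e)%N by nlia.
  have [_ EG] := card_hol4 e2 sHG iHG c2.
  have := NG (transl 1%R); rewrite EG inE => /(_ isT).
  by rewrite /regular_elt mul_part_transl transl1 unitr1 mod4_1_1.
have [x Gx /negP[]] := perm_model_pow sHG iHG modp.
have [Rx _ x2] := hol_pow_eN2 e_ge2 x e_ge3.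
by rewrite (transl_eq Rx); apply: half_transl_in => //; apply/x2/NG.
Qed.

(** The claim is that p kills H, so that H is a kernel. Otherwise some h in H has p h =
    [0, 1 + 2^(e-1)], and commutators with h multiply first coordinates in the image by 2^(e-1). An
    element g over 2 forces h to be so close to the identity that all its commutators are
    translations of order at most 2, hence in the core; an element over 1 then gives a
    contradiction. *)
Lemma no_model_not_normal G H p : H \subset G -> #|G : H| = (2 ^ e)%N ->
  #|H :&: holN e| = 2%N -> ~ (H <| G) -> ~ perm_model G H p.
Proof.
move=> sHG iHG c2 nnH modp; have [pM pH] := modp.
have c2' : (2 <= #|H :&: holN e|)%N by rewrite c2.
have halfJ x y : r x = 1%R -> (2 * x.1 = 0)%R -> x ^ y \in H by exact: half_conj.
have [e2|e_ge3] : e = 2 \/ (3 <= e)%N by nlia.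
  case: nnH; have [cH EG] := card_hol4 e2 sHG iHG c2'.
  have EH : H :&: holN e = H by apply/eqP; rewrite eqEcard subsetIl c2 cH.
  rewrite /normal sHG; apply/normsP => y _; apply/eqP; rewrite eqEcard cardJg leqnn andbT.
  apply/subsetP => _ /imsetP[x Hx ->].
  have Rx : r x = 1%R by apply/eqP; rewrite -in_holN; move: Hx; rewrite -EH inE => /andP[].
  by apply: halfJ => //; apply: meet_holN_card2 Hx Rx.
have trT := perm_model_transitive e_ge2 pM sHG iHG modp.
(* A 2^(e-1)-th power in G is a translation of order at most 2, hence in H, so the image contains no
   regular element. *)
have T2 x : x \in G -> ((p x).1 \is a GRing.unit) = ~~ mod4_1 (r (p x)).
  have [[_ /morphimP[y _ Gy ->] Ry]|T2 Gx] := transitive_cases e_ge2 trT; last first.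
    by apply: T2; apply: (mem_morphim (Morphism pM)).
  have lt_e : (e.-1 < e)%N by nlia.
  have /negP[] := hol_pow_regular e_ge2 lt_e (Ry : regular_elt (p y)).
  rewrite -(morph_pow _ pM) // pH; last exact: groupX.
  have [Rz z2] := hol_pow_eN1 e_ge2 y.
  by rewrite (transl_eq Rz); apply: half_transl_in.
case: nnH.
have sHK : H \subset 'ker (Morphism pM).
  apply/subsetP => h0 Hh0; have Gh0 := subsetP sHG _ Hh0.
  apply/kerP => //; apply/eqP; apply: contraT => ph0.
  have p0 : (p h0).1 = 0%R by apply/eqP; rewrite pH.
  have Mc : mod4_1 (r (p h0)).
    by have := T2 _ Gh0; rewrite p0 unitr0 => /esym/negbFE.
  have [i [t /andP[i2 le_ie] Ec]] := mod4_1_factor e_ge2 Mc.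
  have lt_ie : (i < e)%N.
    rewrite ltn_neqAle le_ie andbT; apply: contraNneq ph0 => Ei.
    by apply/eqP/hol_eqP; rewrite // Ec Ei Z2_exp2e // mul0r addr0.
  (* 1 + 2^(e-1) is the involution in the cyclic group of units 1 mod 4, so a power of any
     nontrivial unit there reaches it. *)
  have [h Hh Ep] : exists2 h, h \in H & r (p h) = (1 + 2 ^+ e.-1)%R.
    exists (h0 ^+ (2 ^ (e.-1 - i))); first exact: groupX.
    have [q [_ E]] := hol_pow_mod4_1 e_ge2 (e.-1 - i) Mc.
    rewrite (morph_pow _ pM) // E Ec; congr (_ + _)%R.
    have z2 : (2 ^+ i * 2 ^+ (e.-1 - i) * 2 = 0 :> Z)%R.
      by rewrite -exprD -exprSr Z2_exp2_ge //; nlia.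
    have -> : (2 ^+ e.-1 = 2 ^+ i * 2 ^+ (e.-1 - i) :> Z)%R.
      by rewrite -exprD subnKC //; nlia.
    by apply: (lincomb1 (t + q + 2 * t * q)%R z2); ring.
  have Gh := subsetP sHG _ Hh; have ph1 : (p h).1 = 0%R by apply/eqP; rewrite pH.
  have zm : (2 * 2 ^+ e.-1 = 0 :> Z)%R by rewrite -exprS Z2_exp2_ge //; nlia.
  have [g Gg Eg] := perm_model_trans e_ge2 sHG iHG modp 2%R.
  have Mg : mod4_1 (r (p g)).
    by have := T2 _ Gg; rewrite Eg -{1}[2%R]mulr1 (negbTE (Z2_2N e_ge2 _)) => /esym/negbFE.
  (* Otherwise g^(2^(e-2)) is a translation of order at most 2, hence in H, although its image has
     first coordinate 2^(e-1). *)
  have /andP[Ug Mrg] : regular_elt g.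
    apply: contraT => Ng; have [Rx _ /(_ Ng) x2] := hol_pow_eN2 e_ge2 g e_ge3.
    have [q [Eq _]] := hol_pow_mod4_1 e_ge2 e.-2 Mg.
    have : (p (g ^+ (2 ^ e.-2))).1 == 0%R.
      by rewrite pH; [rewrite (transl_eq Rx); apply: half_transl_in | exact: groupX].
    rewrite (morph_pow _ pM) // Eq Eg => /eqP E.
    have lt_e : (e.-1 < e)%N by nlia.
    have /negP[] := Z2_exp2_odd e_ge2 q lt_e; apply/eqP; rewrite -[RHS]E.
    have -> : (2 ^+ e.-1 = 2 ^+ e.-2 * 2 :> Z)%R by rewrite -exprSr; congr (_ ^+ _)%R; nlia.
    by ring.
  have cmgH y : y \in G -> (p (cmg h y)).1 = ((p y).1 * 2 ^+ e.-1)%R.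
    by move=> Gy; rewrite (morph_cmg pM) // add_part_cmg ph1 Ep; ring.
  have cg2 : (2 * (cmg h g).1 = 0)%R.
    apply: (meet_holN_card2 c2 _ (mul_part_cmg h g)).
    by rewrite -pH ?in_cmg // cmgH // Eg zm.
  have [s Es] := mod4_1P _ Mrg.
  move: cg2; rewrite add_part_cmg Es => cg2.
  have [k [y le_ke Eh]] := Z2_factor e_ge2 h.1.
  (* If h.1 were 2^k times an odd number with k < e-2, then [cg2] would make h = 1 mod 4, and
     h^(2^(e-2-k)) would be a translation of order 4 in H. *)
  have [v Ev] : exists v, h.1 = (2 ^+ e.-2 * v)%R.
    have [le_k|lt_k] := leqP e.-2 k.
      exists (2 ^+ (k - e.-2) * (1 + 2 * y))%R.
      by rewrite Eh mulrA -exprD subnKC.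
    have Mb : mod4_1 (r h).
      have [w Ew] : exists w, (2 * (r h - 1 - 4 * w) = 0)%R.
        have Ew := divrK Ug (s * h.1)%R.
        exists (s * h.1 / g.1)%R; move: (_ / _)%R Ew => w Ew.
        by apply: (mulIr Ug); apply: (lincomb2 1%R (- 8)%R cg2 Ew); ring.
      have [q Eq] : exists q, (r h - 1 - 4 * w = 2 ^+ (e - 1) * q)%R.
        by apply: (@Z2_annihilator _ e_ge2 1); [nlia | rewrite expr1 Ew].
      apply/mod4_1P; exists (w + 2 ^+ (e - 3) * q)%R.
      have E4 : (2 ^+ (e - 1) = 4 * 2 ^+ (e - 3) :> Z)%R.
        have -> : (e - 1 = (e - 3).+2)%N by nlia.
        by rewrite !exprS; ring.
      by rewrite E4 in Eq; apply: (lincomb1 1%R Eq); ring.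
    have [t' [E1 E2]] := hol_pow_mod4_1 e_ge2 (e.-2 - k) Mb.
    have Rh : r (h ^+ (2 ^ (e.-2 - k))) = 1%R.
      rewrite E2; have -> : (2 ^+ (e.-2 - k) = 2 * 2 ^+ (e.-2 - k.+1) :> Z)%R.
        by rewrite -exprS; congr (_ ^+ _)%R; nlia.
      apply: (mulIr Ug).
      have z8 : (8 * 2 ^+ k * 2 ^+ (e.-2 - k.+1) = 0 :> Z)%R.
        have -> : (8 = 2 ^+ 3 :> Z)%R by ring.
        by rewrite -!exprD Z2_exp2_ge //; nlia.
      rewrite Eh in cg2.
      apply: (lincomb2 (2 ^+ (e.-2 - k.+1) * (1 + 2 * t'))%R (s * (1 + 2 * t') * (1 + 2 * y))%R cg2 z8).
      by ring.
    have := meet_holN_card2 c2 (groupX _ Hh) Rh; rewrite E1 Eh => E.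
    have lt_e : (e.-1 < e)%N by nlia.
    have /negP[] := Z2_exp2_odd e_ge2 (t' + y + 2 * t' * y)%R lt_e; apply/eqP; rewrite -[RHS]E.
    have -> : (2 ^+ e.-1 = 2 * (2 ^+ (e.-2 - k) * 2 ^+ k) :> Z)%R.
      by rewrite -exprD -exprS; congr (_ ^+ _)%R; nlia.
    by ring.
  have z4 : (2 ^+ e.-2 * 4 = 0 :> Z)%R.
    have -> : (4 = 2 ^+ 2 :> Z)%R by ring.
    by rewrite -exprD Z2_exp2_ge //; nlia.
  have b2 : (2 * (r h - 1) = 0)%R.
    apply: (mulIr Ug); rewrite Ev in cg2.
    by apply: (lincomb2 1%R (2 * v * s)%R cg2 z4); ring.
  have [x Gx Ex] := perm_model_trans e_ge2 sHG iHG modp 1%R.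
  have pc1 : p (cmg h x) = 1.
    apply: (perm_model_ker e_ge2 sHG iHG modp); first exact: in_cmg.
    move=> z _; apply: halfJ; first exact: mul_part_cmg.
    have [d Ed] := Z2_unit_odd e_ge2 (mul_partU x).
    rewrite add_part_cmg Ev Ed.
    by apply: (lincomb2 x.1 (- v * d)%R b2 z4); ring.
  have /negP[] : (2 ^+ e.-1 != 0 :> Z)%R by rewrite Z2_exp2_eq0 //; nlia.
  by have := cmgH x Gx; rewrite pc1 Ex mul1r add_part1 => <-.
suff -> : H :=: 'ker (Morphism pM) by apply: ker_normal.
apply/eqP; rewrite eqEsubset sHK /=.
by have [] := perm_model_stab pM sHG pH.
Qed.

(** In a model, p h is an involution fixing 0 with unit 1 mod 4, so squares of its commutators fix
    0. Pulled back, those squares lie in both H and N and are trivial. Thus commutators with h have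
    order at most 2 in G, and as h.1 is odd this spreads to all commutators, contradicting the size
    assumption. *)
Lemma no_model_inverting G H p h : H \subset G -> #|G : H| = (2 ^ e)%N ->
  hol_transitive G -> #|H :&: holN e| = 1%N ->
  h \in H -> h.1 \is a GRing.unit -> r h = (-1)%R ->
  (forall x, x \in G -> x.1 = 0%R -> 2 * (r x - 1) = 0)%R ->
  (8 <= #|G :&: holN e| \/ #|[~: G, G]| = 4) ->
  ~ perm_model G H p.
Proof.
move=> sHG iHG trG c1 Hh Uh Rh stabG cG modp; have [pM pH] := modp.
have Gh := subsetP sHG _ Hh.
have N4h : ~~ mod4_1 (r h).
  by apply/(mod4_3P e_ge2 (mul_partU h)); exists 0%R; rewrite Rh; ring.
suff [c2 cG4] : #|[~: G, G]| <= 2 /\ #|G :&: holN e| <= 4 by case: cG; nlia.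
have keyh x : x \in G -> (2 * (cmg h x).1 = 0)%R.
  move=> Gx; have [e2|e_ge3] : e = 2 \/ (3 <= e)%N by nlia.
    have z4 : (2 ^+ 2 = 0 :> Z)%R by rewrite Z2_exp2_ge // e2.
    have [d Ed] := Z2_unit_odd e_ge2 (mul_partU x).
    have [k Ek] := Z2_unit_odd e_ge2 (mul_partU h).
    rewrite add_part_cmg Ed Ek.
    by apply: (lincomb1 (x.1 * k - h.1 * d)%R z4); ring.
  have GT2 y : y \in G -> ~~ regular_elt y.
    (* Some power of a regular y agrees with h at 0. The quotient s lies in the stabiliser, whose
       units are 1 mod 4 by [stabG], so h would be 1 mod 4 as well. *)
    move=> Gy; apply: contraTN isT => Ry.
    have [i Ei] := regular_powers e_ge2 h.1 Ry.
    pose s := (y ^+ i)^-1 * h.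
    have Gs : s \in G by rewrite groupM ?groupV ?groupX.
    have s0 : s.1 = 0%R.
      by rewrite /s add_partM add_partV mul_partV Ei addrC subrr.
    have /andP[_ My] := Ry.
    have Ms : mod4_1 (r s).
      have /eqP := stabG s Gs s0; rewrite Z2_annihilator_val // !inE => /orP[] /eqP E.
        by apply/mod4_1P; exists 0%R; apply: (lincomb1 1%R E); ring.
      have E4 : (2 ^+ e.-1 = 4 * 2 ^+ (e - 3) :> Z)%R.
        have -> : (e.-1 = (e - 3).+2)%N by nlia.
        by rewrite !exprS; ring.
      by rewrite E4 in E; apply/mod4_1P; exists (2 ^+ (e - 3))%R; apply: (lincomb1 1%R E); ring.
    have Eh : h = y ^+ i * s by rewrite mulKVg.
    have : mod4_1 (r h).
      rewrite Eh mul_partM mod4_1M // Ms mul_partX eqb_id expr_geom.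
      have [a Ea] := mod4_1P _ My; rewrite Ea; apply/mod4_1P.
      by exists (a * geom (1 + 4 * a) i)%R; ring.
    by rewrite (negbTE N4h).
  have trT := perm_model_transitive e_ge2 pM sHG iHG modp.
  have Mph : mod4_1 (r (p h)).
    have ph0 : (p h).1 = 0%R by apply/eqP; rewrite pH.
    have [[_ /morphimP[y _ Gy ->] Ry]|T2] := transitive_cases e_ge2 trT; last first.
      have := T2 (p h) (mem_morphim (Morphism pM) Gh Gh).
      by rewrite ph0 unitr0 => /esym/negbFE.
    have lt_e : (e.-1 < e)%N by nlia.
    have := hol_pow_regular e_ge2 lt_e (Ry : regular_elt (p y)).
    rewrite -(morph_pow _ pM) // (hol_pow_eN1_nonregular e_ge2 (GT2 y Gy)).
    have -> : p 1 = 1 by exact: (morph1 (Morphism pM)).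
    by rewrite add_part1 eqxx.
  have hh1 : h * h = 1.
    apply: (meet_holN_trivial c1); first exact: groupM.
    by rewrite mul_partM Rh; ring.
  have c2 : (2 * (r (p h) - 1) = 0)%R.
    have p1 : p 1 = 1 by exact: (morph1 (Morphism pM)).
    have := congr1 (@mul_part e) (pM _ _ Gh Gh); rewrite hh1 p1 mul_part1 mul_partM.
    have [s ->] := mod4_1P _ Mph => E.
    apply: (mulIr (Z2_odd_unit e_ge2 s)).
    by apply: (lincomb1 (- 1)%R E); ring.
  have ph0 : (p h).1 = 0%R by apply/eqP; rewrite pH.
  have Gk := in_cmg Gh Gx.
  have Rk2 : r (cmg h x * cmg h x) = 1%R by rewrite mul_partM mul_part_cmg mulr1.
  have k2 : cmg h x * cmg h x = 1.
    apply: (meet_holN_trivial c1 _ Rk2).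
    rewrite -pH; last exact: groupM.
    rewrite (pM _ _ Gk Gk) (morph_cmg pM) // add_partM mul_part_cmg add_part_cmg ph0.
    by apply/eqP; apply: (lincomb1 (p x).1 c2); ring.
  have := congr1 fst k2; rewrite add_partM mul_part_cmg add_part1 => E.
  by apply: (lincomb1 1%R E); ring.
(* Modulo 2^(e-1), [keyh] says that 1 - r x equals 2 x.1 / h.1, so the two terms of the commutator
   of x and y cancel. *)
have keyG x y : x \in G -> y \in G -> (2 * (cmg x y).1 = 0)%R.
  move=> Gx Gy; have := keyh x Gx; have := keyh y Gy.
  rewrite !add_part_cmg Rh => Ey Ex; apply: (mulIr Uh).
  by apply: (lincomb2 x.1 (- y.1)%R Ey Ex); ring.
split; last first.
  have [k le_ke cN] := card_meet_holN e_ge2 G.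
  rewrite cN (@leq_exp2l 2 _ 2) // leqNgt; apply/negP => k3.
  (* The commutator of h with this translation is the translation by -2^(e-2), which 2 does not
     kill. *)
  have Gy : transl (2 ^+ (e - 3) * 1)%R \in G.
    by apply: transl_sub => //; [nlia | rewrite cN (@leq_exp2l 2 3)].
  have := keyh _ Gy; rewrite add_part_cmg mul_part_transl transl1 Rh => E.
  have /negP[] : (2 ^+ e.-1 != 0 :> Z)%R by rewrite Z2_exp2_eq0 //; nlia.
  have -> : (2 ^+ e.-1 = 4 * 2 ^+ (e - 3) :> Z)%R.
    have -> : (e.-1 = (e - 3).+2)%N by nlia.
    by rewrite !exprS; ring.
  by apply/eqP; apply: (lincomb1 (-1)%R E); ring.
pose V := [set transl 0%R; transl (2 ^+ e.-1)%R : hol e].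
have VP x : (x \in V) = (r x == 1%R) && (2 * x.1 == 0)%R.
  rewrite Z2_annihilator_val // !inE; apply/orP/andP => [[] /eqP->|].
  - by rewrite mul_part_transl !eqxx.
  - by rewrite mul_part_transl !eqxx orbT.
  by case=> /eqP/transl_eq Ex /orP[] /eqP E; [left|right]; rewrite Ex E.
have gV : group_set V.
  apply/group_setP; split=> [|x y]; first by rewrite VP mulr0 !eqxx.
  rewrite !VP add_partM mul_partM => /andP[/eqP-> /eqP x2] /andP[/eqP-> /eqP y2].
  by rewrite !mulr1 mulrDr x2 y2 addr0 !eqxx.
have sV : [~: G, G] \subset V.
  rewrite -[V]/(gval (Group gV)) gen_subG; apply/subsetP => _ /imset2P[x y Gx Gy ->].
  have -> : [~ x, y] = cmg x^-1 y^-1.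
    by rewrite /cmg invMg !invgK /commg /conjg mulgA.
  change (cmg x^-1 y^-1 \in V).
  by rewrite VP mul_part_cmg keyG ?groupV ?eqxx.
by rewrite (leq_trans (subset_leq_card sV)) // cards2; case: (_ != _).
Qed.
End NoModel.

(** * 2-groups with a cyclic subgroup of index 2 *)

Lemma dprod_cycles (gT : finGroupType) (a b : gT) : commute a b -> #[b] = 2 ->
  b \notin <[a]> -> (<[a]> \x <[b]> = <[a]> <*> <[b]>) /\ #|<[a]> <*> <[b]>| = (#[a] * 2)%N.
Proof.
move=> cab ob nba.
have ti : <[a]> :&: <[b]> = 1.
  rewrite setIC; apply: prime_TIg; first by rewrite -orderE ob.
  by rewrite cycle_subG.
have cent : <[b]> \subset 'C(<[a]>).
  by rewrite cent_cycle cycle_subG; apply/cent1P.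
split; first exact: dprodEY.
by rewrite cent_joinEr // TI_cardMg // -!orderE ob.
Qed.

(** Take y outside <a>, with y^2 = a^k. For even k, y a^(-k/2) is the involution; for odd k, y^2
    generates <a>, so y generates G, which was excluded. *)
Lemma abelian_index2_cycle (gT : finGroupType) (G : {group gT}) (a : gT) :
  2.-group G -> abelian G -> ~~ cyclic G -> a \in G -> #|G : <[a]>| = 2 ->
  exists b, [/\ b \in G, #[b] = 2 & b \notin <[a]>].
Proof.
move=> pG abG ncG Ga iG; have sXG : <[a]> \subset G by rewrite cycle_subG.
have [y Gy nXy] : exists2 y, y \in G & y \notin <[a]>.
  apply/subsetPn; apply/negP => sGX; move: iG.
  by have -> : <[a]> = G; [apply/eqP; rewrite eqEsubset sXG | rewrite indexgg].
have nX := index2_normal sXG iG.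
have : y ^+ 2 \in <[a]>.
  have Ny := subsetP (normal_norm nX) _ Gy.
  rewrite coset_idr ?groupX // morphX //=.
  apply/eqP; rewrite -order_dvdn -iG -card_quotient ?normal_norm //.
  by rewrite order_dvdG ?mem_quotient.
case/cycleP => k Ek; have cay : commute a y by apply: (centsP abG).
have p2 : prime 2 by [].
have Ek2 : k = (odd k + (k./2).*2)%N by rewrite odd_double_half.
case Ok: (odd k) Ek2 => Ek2; last first.
  exists (y * (a ^+ k./2)^-1); split.
  - by rewrite groupM ?groupV ?groupX.
  - apply: nt_prime_order => //.
      rewrite expgMn; last exact/commuteV/commuteX/commute_sym.
      rewrite Ek expgVn -expgM muln2 {1}Ek2 add0n mulgV //.
    by apply: contraNneq nXy => /(canRL (mulgKV _)) ->; rewrite mul1g mem_cycle.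
  by rewrite groupMr ?groupV ?mem_cycle.
case/negP: ncG; suff -> : G :=: <[y]> by apply: cycle_cyclic.
apply/eqP; rewrite eq_sym eqEcard cycle_subG Gy /=.
have pa : 2.-elt a by apply: mem_p_elt Ga.
have gX : <[a]> = <[y ^+ 2]>.
  apply/eqP; rewrite Ek eq_sym; rewrite [_ == _](_ : _ = generator <[a]> (a ^+ k)).
    rewrite generator_coprime coprime_sym; have [i oi] := p_natP pa.
    by rewrite oi coprimeXr // coprimen2 Ok.
  by rewrite /generator eq_sym.
have sXy : <[a]> \proper <[y]>.
  by rewrite properE gX cycleX -gX cycle_subG nXy.
have := proper_card sXy; rewrite -(Lagrange sXG) iG.
have : #|<[a]>| %| #|<[y]>| by rewrite cardSg ?proper_sub.
by case/dvdnP => q ->; case: q => [|[|q]]; rewrite ?mul0n ?mul1n ?ltnn // => _; rewrite mulnC leq_mul2r; nlia.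
Qed.

(** * Regular embeddings of these 2-groups into Hol(N) *)

Section RegularEmbedding.
Context {e : nat} (e_ge2 : (2 <= e)%N).
Local Notation Z := 'Z_(2 ^ e).
Implicit Types (x y g h : hol e) (u v w a b : Z) (T G H X : {group hol e}).
Local Notation r := mul_part.

(** The powers of x reach the even points, and y times them the odd ones. *)
Lemma transitive_gen2 x y T : x.1 = 2%R -> mod4_1 (r x) -> y.1 = 1%R ->
  x \in T -> y \in T -> hol_transitive T.
Proof.
move=> Ex Mx Ey Tx Ty; apply/(transitive_add_part T) => v.
case: (Z2_parity v) => -[t ->].
  have [i Ei] := geom_surj e_ge2 t Mx.
  by exists (x ^+ i); rewrite ?groupX // add_partX Ei Ex.
have [i Ei] := geom_surj e_ge2 (t / r y)%R Mx.
exists (y * x ^+ i); first by rewrite groupM ?groupX.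
by rewrite add_partM add_partX Ex Ey Ei -mulrA (divrK (mul_partU y)).
Qed.

Lemma transitive_card_ge T : hol_transitive T -> (2 ^ e <= #|T|)%N.
Proof.
move/(transitive_index e_ge2 T) => <-.
by rewrite -(Lagrange (subsetIl T (holAut e))) leq_pmull ?cardG_gt0.
Qed.

(** Transitivity gives <x, y> at least 2^e elements, so being a homomorphic image of A already makes
    it isomorphic to A. The nonabelian embeddings below therefore only check defining relations. *)
Lemma isog_gen2 (rT : finGroupType) (A : {group rT}) x y : #|A| = (2 ^ e)%N ->
  x.1 = 2%R -> mod4_1 (r x) -> y.1 = 1%R ->
  <[x]> <*> <[y]> \homg A -> exists T, hol_transitive T /\ A \isog T.
Proof.
move=> cA Ex Mx Ey hT; exists (<[x]> <*> <[y]>)%G.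
have trT : hol_transitive (<[x]> <*> <[y]>)%G.
  by apply: (@transitive_gen2 x y) => //=; rewrite mem_gen // inE cycle_id ?orbT.
by split=> //; rewrite isog_sym isogEcard hT cA transitive_card_ge.
Qed.

Lemma order_double x : x.1 = 2%R -> mod4_1 (r x) -> #[x] = (2 ^ e.-1)%N.
Proof.
move=> Ex Mx.
have Nx : ~~ regular_elt x by rewrite /regular_elt Ex -[2%R]mulr1 (negbTE (Z2_2N e_ge2 _)).
have : #[x] %| 2 ^ e.-1 by rewrite order_dvdn (hol_pow_eN1_nonregular e_ge2 Nx).
case/(dvdn_pfactor _ _ (isT : prime 2)) => i le_ie Oi; rewrite Oi.
have [lt_ie|le_ei] := ltnP i e.-1; last by congr (_ ^ _)%N; nlia.
have [t [Et _]] := hol_pow_mod4_1 e_ge2 i Mx.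
have lt_ie' : (i.+1 < e)%N by nlia.
have /negP[] := Z2_exp2_odd e_ge2 t lt_ie'; apply/eqP.
have : x ^+ (2 ^ i) = 1 by rewrite -Oi expg_order.
by move/(congr1 fst); rewrite Et Ex add_part1 => <-; rewrite exprS; ring.
Qed.

Lemma mod4_1_mk u a : mod4_1 a -> mod4_1 (r (mkhol u a)).
Proof. by move=> Ma; rewrite mkhol2 // mod4_1_unit. Qed.

Lemma half_mod4_1 : (3 <= e)%N -> mod4_1 (1 + 2 ^+ e.-1 : Z)%R.
Proof.
move=> e3; apply/mod4_1P; exists (2 ^+ (e - 3))%R.
have -> : (e.-1 = (e - 3).+2)%N by nlia.
by rewrite !exprS; ring.
Qed.

Lemma half_double : (2 * 2 ^+ e.-1 = 0 :> Z)%R.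
Proof. by rewrite -exprS Z2_exp2_ge //; nlia. Qed.

Lemma half_sqr : (2 ^+ e.-1 * 2 ^+ e.-1 = 0 :> Z)%R.
Proof. by rewrite -exprD Z2_exp2_ge //; nlia. Qed.

Lemma double_pow x : (3 <= e)%N -> x.1 = 2%R -> mod4_1 (r x) ->
  x ^+ (2 ^ e.-2) = transl (2 ^+ e.-1)%R.
Proof.
move=> e3 Ex Mx.
have z4 : (2 ^+ e.-2 * 4 = 0 :> Z)%R.
  have -> : (4 = 2 ^+ 2 :> Z)%R by ring.
  by rewrite -exprD Z2_exp2_ge //; nlia.
have z2 : (2 ^+ e.-2 * 2 = 2 ^+ e.-1 :> Z)%R.
  by rewrite -exprSr; congr (_ ^+ _)%R; nlia.
have [t [E1 E2]] := hol_pow_mod4_1 e_ge2 e.-2 Mx.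
apply: hol_eqP; rewrite ?mul_part_transl ?transl1.
  by rewrite E1 Ex; apply: (lincomb2 1%R t z2 z4); ring.
by rewrite E2; have [s ->] := mod4_1P _ Mx; apply: (lincomb1 (s * (1 + 2 * t))%R z4); ring.
Qed.

Let N1u : (-1 : Z)%R \is a GRing.unit. Proof. by rewrite unitrN1. Qed.

Lemma neg1_sqr u : (mkhol u (-1)%R) ^+ 2 = 1 :> hol e.
Proof.
rewrite expgS expg1; apply: hol_eqP; rewrite !partsM mkhol2 // ?mkhol1; ring.
Qed.

Lemma embed_modular : (3 <= e)%N ->
  exists T, hol_transitive T /\ [set: 'Mod_(2 ^ e)] \isog T.
Proof.
(* b is dictated by the relation x^y = x^(1 + 2^(e-2)): first coordinates in x y = y x^(1 + 2^(e-2))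
   give 2 + b = -1 + 2^(e-1). *)
move=> e3; pose b := (1 + 2 ^+ e.-1 - 4 : Z)%R.
have Mb : mod4_1 b.
  have [s Es] := mod4_1P _ (half_mod4_1 e3).
  by apply/mod4_1P; exists (s - 1)%R; rewrite /b Es; ring.
pose x : hol e := mkhol 2%R b; pose y : hol e := mkhol 1%R (-1)%R.
apply: (@isog_gen2 _ [set: 'Mod_(2 ^ e)]%G x y); rewrite ?card_modular_group ?mkhol1 ?mod4_1_mk //.
rewrite Grp_modular_group //; apply/existsP; exists (x, y).
have Mx : mod4_1 (r x) by apply: mod4_1_mk.
have rx : r x = b by rewrite mkhol2 // mod4_1_unit.
have ry : r y = (-1)%R by rewrite mkhol2.
have xE : x ^+ (2 ^ e.-2) = transl (2 ^+ e.-1)%R by apply: double_pow.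
have ox : x ^+ (2 ^ e.-1) = 1 by rewrite -(order_double (x := x)) // expg_order.
have y2 : y ^+ 2 = 1 by apply: neg1_sqr.
have xy : x ^ y = x ^+ (2 ^ e.-2).+1.
  apply: (mulgI y); rewrite -conjgC expgS xE.
  apply: hol_eqP; last by rewrite !mul_partM mul_part_transl rx ry; ring.
  rewrite !add_partM transl1 rx ry ?[x.1]mkhol1 ?[y.1]mkhol1.
  by rewrite /b; apply: (lincomb2 1%R (-1)%R half_sqr half_double); ring.
by rewrite /=; apply/eqP; rewrite ox y2 xy.
Qed.

Lemma embed_dihedral : exists T, hol_transitive T /\ [set: 'D_(2 ^ e)] \isog T.
Proof.
pose x : hol e := mkhol 2%R 1%R; pose y : hol e := mkhol 1%R (-1)%R.
have rx : r x = 1%R by rewrite mkhol2 ?unitr1.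
have ry : r y = (-1)%R by rewrite mkhol2.
have Mx : mod4_1 (r x) by rewrite rx mod4_1_1.
apply: (@isog_gen2 _ [set: 'D_(2 ^ e)]%G x y); rewrite ?card_2dihedral ?mkhol1 //.
rewrite Grp_2dihedral //; apply/existsP; exists (x, y).
have ox : x ^+ (2 ^ e.-1) = 1 by rewrite -(order_double (x := x)) // expg_order.
have y2 : y ^+ 2 = 1 by apply: neg1_sqr.
have xy : x ^ y = x^-1.
  apply: (mulgI y); rewrite -conjgC; apply: hol_eqP.
    by rewrite !add_partM add_partV rx ry divr1 [x.1]mkhol1 [y.1]mkhol1; ring.
  by rewrite !mul_partM mul_partV rx ry invr1; ring.
by rewrite /=; apply/eqP; rewrite ox y2 xy.
Qed.

Lemma embed_quaternion : (3 <= e)%N ->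
  exists T, hol_transitive T /\ [set: 'Q_(2 ^ e)] \isog T.
Proof.
move=> e3; pose x : hol e := mkhol 2%R 1%R.
(* This unit makes y^2 the translation by 1 + (2^(e-1) - 1) = 2^(e-1), which is x^(2^(e-2)). *)
pose y : hol e := mkhol 1%R (2 ^+ e.-1 - 1)%R.
have rx : r x = 1%R by rewrite mkhol2 ?unitr1.
have ry : r y = (2 ^+ e.-1 - 1)%R.
  rewrite mkhol2 //; have [t Et] := Z2_unit_odd e_ge2 (mod4_1_unit e_ge2 (half_mod4_1 e3)).
  by apply/(Z2_odd_unitE e_ge2); exists (t - 1)%R; apply: (lincomb1 1%R Et); ring.
have Mx : mod4_1 (r x) by rewrite rx mod4_1_1.
apply: (@isog_gen2 _ [set: 'Q_(2 ^ e)]%G x y); rewrite ?card_quaternion ?mkhol1 //.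
rewrite Grp_quaternion //; apply/existsP; exists (x, y).
have ox : x ^+ (2 ^ e.-1) = 1 by rewrite -(order_double (x := x)) // expg_order.
have y2 : y ^+ 2 = x ^+ (2 ^ e.-2).
  rewrite double_pow // expgS expg1; apply: hol_eqP.
    by rewrite !add_partM transl1 ry [y.1]mkhol1; ring.
  by rewrite !mul_partM mul_part_transl ry; apply: (lincomb2 1%R (-1)%R half_sqr half_double); ring.
have xy : x ^ y = x^-1.
  apply: (mulgI y); rewrite -conjgC; apply: hol_eqP.
    rewrite !add_partM add_partV rx ry divr1 [x.1]mkhol1 [y.1]mkhol1.
    by apply: (lincomb1 1%R half_double); ring.
  by rewrite !mul_partM mul_partV rx ry invr1; ring.
by rewrite /=; apply/eqP; rewrite ox y2 xy.
Qed.

Lemma embed_semidihedral : (4 <= e)%N ->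
  exists T, hol_transitive T /\ [set: 'SD_(2 ^ e)] \isog T.
Proof.
move=> e4; have e3 : (3 <= e)%N by nlia.
pose x : hol e := mkhol 2%R (1 + 2 ^+ e.-1)%R.
pose y : hol e := mkhol 1%R (-1)%R.
have Mx : mod4_1 (r x) by rewrite mod4_1_mk ?half_mod4_1.
have rx : r x = (1 + 2 ^+ e.-1)%R by rewrite mkhol2 // mod4_1_unit ?half_mod4_1.
have ry : r y = (-1)%R by rewrite mkhol2.
apply: (@isog_gen2 _ [set: 'SD_(2 ^ e)]%G x y); rewrite ?card_semidihedral ?mkhol1 //.
rewrite Grp_semidihedral //; apply/existsP; exists (x, y).
have ox : x ^+ (2 ^ e.-1) = 1 by rewrite -(order_double (x := x)) // expg_order.
have y2 : y ^+ 2 = 1 by apply: neg1_sqr.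
have xy : x ^ y = x ^+ (2 ^ e.-2).-1.
  apply: (mulgI y); apply: (mulIg x); rewrite -conjgC -[RHS]mulgA -expgSr prednK ?expn_gt0 //.
  rewrite double_pow //; apply: hol_eqP.
    by rewrite !add_partM !mul_partM transl1 rx ry [x.1]mkhol1 [y.1]mkhol1; ring.
  rewrite !mul_partM mul_part_transl rx ry.
  by apply: (lincomb2 (-1)%R (-1)%R half_sqr half_double); ring.
by rewrite /=; apply/eqP; rewrite ox y2 xy.
Qed.

Lemma embed_abelian (gT : finGroupType) (A : {group gT}) (a : gT) :
  abelian A -> ~~ cyclic A -> a \in A -> #[a] = (2 ^ e.-1)%N -> #|A| = (2 ^ e)%N ->
  exists T, hol_transitive T /\ A \isog T.
Proof.
move=> abA ncA Aa oa cA.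
have Ee : (2 ^ e = 2 ^ e.-1 * 2)%N by rewrite -expnSr prednK //; nlia.
have iA : #|A : <[a]>| = 2.
  by rewrite -divgS ?cycle_subG // cA -orderE oa Ee mulKn ?expn_gt0.
have pA : 2.-group A by rewrite /pgroup cA pnatX pnat_id.
have [b [Ab ob nab]] := abelian_index2_cycle pA abA ncA Aa iA.
have [dA c1] := dprod_cycles (centsP abA _ Aa _ Ab) ob nab.
have EA : <[a]> <*> <[b]> = A.
  apply/eqP; rewrite eqEcard join_subG !cycle_subG Aa Ab /=.
  by rewrite c1 cA oa Ee.
rewrite EA in dA.
(* With the unit -3, x commutes with y: both products have first coordinate -1. *)
pose x : hol e := mkhol 2%R (1 - 4)%R; pose y : hol e := mkhol 1%R (-1)%R.
have M3 : mod4_1 (1 - 4 : Z)%R by apply/mod4_1P; exists (-1)%R; ring.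
have Mx : mod4_1 (r x) by rewrite mod4_1_mk.
have rx : r x = (1 - 4)%R by rewrite mkhol2 // mod4_1_unit.
have ry : r y = (-1)%R by rewrite mkhol2.
have ox : #[x] = (2 ^ e.-1)%N by apply: order_double.
have y2 : y ^+ 2 = 1 by apply: neg1_sqr.
have nxy : y \notin <[x]>.
  apply/negP => /cycleP[i /(congr1 fst)]; rewrite add_partX [x.1]mkhol1 [y.1]mkhol1 => /eqP.
  have := Z2_odd_neq_even e_ge2 0%R (geom (r x) i).
  by rewrite mulr0 addr0 => /negbTE->.
have oy : #[y] = 2.
  by apply: nt_prime_order => //; apply: contraNneq nxy => ->; apply: group1.
have cxy : commute x y.
  apply: hol_eqP; last by rewrite !mul_partM mulrC.
  by rewrite !add_partM rx ry [x.1]mkhol1 [y.1]mkhol1; ring.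
have [dT cT] := dprod_cycles cxy oy nxy.
exists (<[x]> <*> <[y]>)%G; split.
  by apply: (@transitive_gen2 x y) => //=; rewrite mem_gen // inE cycle_id ?orbT.
apply: (isog_dprod dA dT).
  by rewrite isog_cyclic_card ?cycle_cyclic //= -!orderE oa ox.
by rewrite isog_cyclic_card ?cycle_cyclic //= -!orderE ob oy.
Qed.

Lemma embed_cyclic (gT : finGroupType) (A : {group gT}) :
  cyclic A -> #|A| = (2 ^ e)%N -> exists T, hol_transitive T /\ A \isog T.
Proof.
move=> cycA cA; exists (holN_group); split.
  apply/(transitive_add_part (holN_group)) => v.
  by exists (transl v) => //; apply: transl_in_holN.
rewrite isog_cyclic_card //= card_holN // cA eqxx andbT.
by rewrite holN_cycle // cycle_cyclic.
Qed.

Lemma embed_index2_cyclic (gT : finGroupType) (A : {group gT}) (a : gT) :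
  a \in A -> #[a] = (2 ^ e.-1)%N -> #|A| = (2 ^ e)%N ->
  exists T, hol_transitive T /\ A \isog T.
Proof.
move=> Aa oa cA.
have Ee : (2 ^ e = 2 ^ e.-1 * 2)%N by rewrite -expnSr prednK //; nlia.
have iA : #|A : <[a]>| = 2.
  by rewrite -divgS ?cycle_subG // cA -orderE oa Ee mulKn ?expn_gt0.
have pA : 2.-group A by rewrite /pgroup cA pnatX pnat_id.
case: (boolP (cyclic A)) => [cycA|ncA]; first exact: embed_cyclic.
case: (boolP (abelian A)) => [abA|nabA]; first exact: (embed_abelian abA ncA Aa).
have trans (B : finGroupType) : A \isog [set: B] ->
    (exists T, hol_transitive T /\ [set: B] \isog T) ->
    exists T, hol_transitive T /\ A \isog T.
  by move=> AB [T [trT BT]]; exists T; split=> //; apply: isog_trans AB BT.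
have pow2 p n : prime p -> (0 < n)%N -> (p ^ n = 2 ^ e)%N -> p = 2 /\ n = e.
  move=> pr_p n0 E; have Ep : p = 2.
    have : p %| 2 ^ e by rewrite -E dvdn_exp.
    by rewrite Euclid_dvdX // dvdn_prime2 // => /andP[/eqP].
  by split=> //; apply/eqP; rewrite -(eqn_exp2l _ _ (ltnSn 1)) -E Ep.
have := maximal_cycle_extremal pA nabA (cycle_cyclic a) _ iA.
rewrite cycle_subG Aa => /(_ isT) /orP[/eqP/modular_group_classP|/andP[_]].
  case=> p pr_p [n n3 AM]; have n2 : (2 < n)%N by apply: leq_trans n3; case: (p == 2%N).
  have := card_isog AM; rewrite cA card_modular_group // => /esym/pow2[//||Ep En]; first nlia.
  by rewrite {}Ep {}En in n2 AM *; apply: trans AM (embed_modular n2).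
rewrite /extremal2 !inE => /or3P[] /eqP.
- case/dihedral_classP => n n2 AD.
  have := card_isog AD; rewrite cA card_2dihedral // => /esym/pow2[//||_ En]; first nlia.
  by rewrite {}En in n2 AD; apply: trans AD embed_dihedral.
- case/semidihedral_classP => n n2 AD.
  have := card_isog AD; rewrite cA card_semidihedral // => /esym/pow2[//||_ En]; first nlia.
  by rewrite {}En in n2 AD; apply: trans AD (embed_semidihedral n2).
case/quaternion_classP => n n2 AD.
have := card_isog AD; rewrite cA card_quaternion // => /esym/pow2[//||_ En]; first nlia.
by rewrite {}En in n2 AD; apply: trans AD (embed_quaternion n2).
Qed.

(** g^(2^(e-2)) is a translation of order 4, so it is not in H and the class of g in G/H has order
    at least 2^(e-1). In a regular embedding of G/H the stabiliser is trivial, so the composite with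
    the projection has zero set H. *)
Lemma perm_model_normal G H g : H <| G -> #|G : H| = (2 ^ e)%N ->
  #|H :&: holN e| = 2%N -> g \in G -> #[g] = (2 ^ e)%N ->
  exists p, perm_model G H p.
Proof.
move=> nHG iHG c2 Gg og; have nH := normal_norm nHG; have Ng := subsetP nH _ Gg.
have cQ : #|G / H| = (2 ^ e)%N by rewrite card_quotient.
have /andP[Ug Mg] : regular_elt g by apply/(order_regularP e_ge2).
have ncH : g ^+ (2 ^ e.-2) \notin H.
  apply/negP => Hg.
  have [t [Et Er]] := hol_pow_mod4_1 e_ge2 e.-2 Mg.
  have z4 : (2 ^+ e.-2 * 4 = 0 :> Z)%R.
    have -> : (4 = 2 ^+ 2 :> Z)%R by ring.
    by rewrite -exprD Z2_exp2_ge //; nlia.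
  have Rg : r (g ^+ (2 ^ e.-2)) = 1%R.
    rewrite Er; have [s ->] := mod4_1P _ Mg.
    by apply: (lincomb1 (s * (1 + 2 * t))%R z4); ring.
  have := meet_holN_card2 c2 Hg Rg; rewrite Et.
  have [y ->] := Z2_unit_odd e_ge2 Ug => E.
  have lt_e : (e.-1 < e)%N by nlia.
  have /negP[] := Z2_exp2_odd e_ge2 (t + y + 2 * t * y)%R lt_e; apply/eqP; rewrite -[RHS]E.
  have -> : (2 ^+ e.-1 = 2 * 2 ^+ e.-2 :> Z)%R by rewrite -exprS; congr (_ ^+ _)%R; nlia.
  by ring.
have [T [trT isoT]] : exists T, hol_transitive T /\ G / H \isog T.
  have : #[coset H g] %| 2 ^ e by rewrite -cQ order_dvdG ?mem_quotient.
  case/(dvdn_pfactor _ _ (isT : prime 2)) => i le_ie Oi.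
  have lt_i : (e.-2 < i)%N.
    rewrite ltnNge; apply/negP => le_i; case/negP: ncH.
    apply: coset_idr; first exact: groupX.
    rewrite morphX //=; apply/eqP; rewrite -order_dvdn Oi dvdn_exp2l //.
  have [Ei|Ei] : i = e \/ i = e.-1 by nlia.
    apply: embed_cyclic => //; apply/cyclicP; exists (coset H g); apply/esym/eqP.
    by rewrite eqEcard cycle_subG mem_quotient //= cQ -orderE Oi Ei.
  by apply: (embed_index2_cyclic (a := coset H g)) => //; rewrite ?mem_quotient // Oi Ei.
have /isogP[f injf fT] := isoT.
have cT : #|T| = (2 ^ e)%N by rewrite -(card_isog isoT).
have st1 : hol_stab T = 1.
  apply: (@card1_trivg _ (hol_stab_group T)) => /=; apply/eqP.
  have iT := (transitive_index e_ge2 T).1 trT.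
  by rewrite -(eqn_pmul2r (expn_gt0 2 e)) -{1}iT Lagrange ?subsetIl // cT mul1n.
exists (fun x => f (coset H x)); split=> [x y Gx Gy|x Gx].
  by rewrite morphM ?(subsetP nH) // morphM ?mem_quotient.
have Qx : coset H x \in G / H by apply: mem_quotient.
have -> : ((f (coset H x)).1 == 0%R) = (f (coset H x) \in hol_stab T).
  by rewrite in_hol_stab -fT mem_morphim.
rewrite st1; apply/set1P/idP => [f1|Hx].
  apply: coset_idr; first exact: (subsetP nH).
  by apply: (injmP injf) => //; rewrite ?group1 // morph1.
by rewrite (coset_id Hx) morph1.
Qed.
End RegularEmbedding.

(** * Subgroups meeting N trivially *)

Section TrivialMeet.
Context {e : nat} (e_ge2 : (2 <= e)%N).
Local Notation Z := 'Z_(2 ^ e).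
Implicit Types (x y g h : hol e) (u v w a b : Z) (T G H X : {group hol e}) (p : hol e -> hol e).
Local Notation r := mul_part.

(** The last clause says H meets N trivially, so [mul_part] is injective on H. The notion is stable
    under conjugation in Hol(N), which is what allows H to be normalised. *)
Definition transversal_pair G H :=
  [/\ hol_transitive G, H \subset G, #|G : H| = (2 ^ e)%N
    & forall h, h \in H -> r h = 1%R -> h = 1].

Lemma mul_partJ x y : r (x ^ y) = r x.
Proof.
have := congr1 mul_part (conjgC x y); rewrite !mul_partM mulrC => E.
exact/esym/(mulrI (mul_partU y)).
Qed.

Lemma transversal_pairJ G H y : transversal_pair G H ->
  transversal_pair (G :^ y)%G (H :^ y)%G.
Proof.
case=> trG sHG iHG H1; split; rewrite /= ?conjSg ?indexJg //.
  move=> v w; have [g Gg Eg] := trG (hol_act y v) (hol_act y w).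
  exists (g ^ y); first by rewrite memJ_conjg.
  by rewrite conjgE !hol_actM Eg -hol_actM mulVg hol_act1.
by move=> _ /imsetP[h Hh ->]; rewrite mul_partJ => /(H1 h Hh)->; rewrite conj1g.
Qed.

Lemma add_partJ_transl x u : (x ^ transl u).1 = (x.1 + u * (r x - 1))%R.
Proof.
have := congr1 fst (conjgC x (transl u)).
rewrite !add_partM mul_part_transl transl1 => E.
by apply: (lincomb1 (-1)%R E); ring.
Qed.

Lemma add_partJ_scale x u : u \is a GRing.unit -> (x ^ (mkhol 0%R u)).1 = (x.1 / u)%R.
Proof.
move=> Uu; have := congr1 fst (conjgC x (mkhol 0%R u)).
rewrite !add_partM mkhol2 // mkhol1 => E.
by apply: (mulIr Uu); rewrite divrK //; apply: (lincomb1 (-1)%R E); ring.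
Qed.

Lemma card_stab_eq G H : transversal_pair G H -> #|hol_stab G| = #|H|.
Proof.
case=> trG sHG iHG _; have iS := (transitive_index e_ge2 G).1 trG.
apply/eqP; rewrite -(eqn_pmul2r (expn_gt0 2 e)) -{1}iS -iHG !Lagrange ?subsetIl //.
Qed.

Lemma perm_model_id G H : transversal_pair G H ->
  (forall h, h \in H -> h.1 = 0%R) -> perm_model G H id.
Proof.
case=> trG sHG iHG _ H0; apply: (perm_model_of_trans e_ge2) => // v.
by have /(transitive_add_part G)/(_ v) := trG.
Qed.

Lemma mulr_unit_eq0 u v : u \is a GRing.unit -> (v * u == 0)%R = (v == 0%R).
Proof.
move=> Uu; apply/eqP/eqP => [E|->]; last by rewrite mul0r.
by apply: (mulIr Uu); rewrite E mul0r.
Qed.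

Lemma neg1_not_mod4_1 x : r x = (-1)%R -> ~~ mod4_1 (r x).
Proof.
move=> Rx; apply/(mod4_3P e_ge2 (mul_partU x)); exists 0%R; rewrite Rx; ring.
Qed.

Lemma mod4_1_mulN x y : ~~ mod4_1 (r x) -> mod4_1 (r (x * y)) = ~~ mod4_1 (r y).
Proof. by move=> /negbTE Nx; rewrite mul_partM mod4_1M // Nx; case: mod4_1. Qed.

(** The stabiliser has the same order as H, namely 2. Whether its involution s is 1 or 3 mod 4
    decides which of the two constructions below applies. *)
Lemma stab_generated G H h0 : transversal_pair G H ->
  h0 \in H -> r h0 = (-1)%R ->
  (forall h, h \in H -> mod4_1 (r h) -> h = 1) -> #|H| = 2 /\
  exists s, [/\ s \in G, s.1 = 0%R, (r s * r s = 1)%R, r s != 1%R &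
    forall s', s' \in G -> s'.1 = 0%R -> s' = 1 \/ s' = s].
Proof.
move=> tGH Hh0 Rh0 H1; have Nh0 := neg1_not_mod4_1 Rh0.
have h02 : h0 * h0 = 1 by apply: H1; rewrite ?groupM // mod4_1_mulN.
have h0N1 : h0 != 1 by apply: contraNneq Nh0 => ->; rewrite mod4_1_1.
have cH : #|H| = 2.
  have -> : H = [set 1; h0] :> {set hol e}.
    apply/setP => h; rewrite !inE; apply/idP/orP => [Hh|[] /eqP->//].
    case: (boolP (mod4_1 (r h))) => [/(H1 h Hh)->|Nh]; first by left.
    right; have E : h0 * h = 1 by apply: H1; rewrite ?groupM ?mod4_1_mulN.
    by apply/eqP/(mulgI h0); rewrite E h02.
  by rewrite cards2 eq_sym h0N1.
split=> //; have cS := card_stab_eq tGH; rewrite cH in cS.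
have [s Ss sN1] : exists2 s, s \in hol_stab G & s != 1.
  have /trivgPn : hol_stab_group G != 1%G.
    by apply/eqP => /(congr1 (fun A : {group hol e} => #|A|)) /=; rewrite cS cards1.
  by case=> s; exists s.
have /andP[Gs /eqP s0] : (s \in G) && (s.1 == 0%R) by rewrite -in_hol_stab.
have ES : hol_stab G = [set 1; s].
  apply/eqP; rewrite eq_sym eqEcard cS cards2 eq_sym sN1 andbT.
  by apply/subsetP=> x; rewrite !inE => /orP[] /eqP->; rewrite -?in_hol_stab ?Ss // group1 eqxx.
have os : s ^+ 2 = 1.
  by apply/eqP; rewrite -order_dvdn -cS (@order_dvdG _ (hol_stab_group G)).
exists s; split=> //.
- by rewrite -mul_partM; have -> : s * s = 1 by rewrite -os expgS expg1.
- by apply: contraNneq sN1 => Rs; apply/eqP/hol_eqP; rewrite ?s0.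
move=> s' Gs' s'0; have : s' \in hol_stab G by rewrite in_hol_stab Gs' s'0 /=.
by rewrite ES !inE => /orP[] /eqP; [left|right].
Qed.

Lemma inverting_mem G H h0 : transversal_pair G H ->
  h0 \in H -> r h0 = (-1)%R ->
  (forall h, h \in H -> mod4_1 (r h) -> h = 1) ->
  forall h, (h \in H) = (h == 1) || (h == h0).
Proof.
move=> tGH Hh0 Rh0 H1 h; have Nh0 := neg1_not_mod4_1 Rh0.
have h02 : h0 * h0 = 1 by apply: H1; rewrite ?groupM // mod4_1_mulN.
apply/idP/orP => [Hh|[] /eqP->//].
case: (boolP (mod4_1 (r h))) => [/(H1 h Hh)->|Nh]; first by left.
right; have E : h0 * h = 1 by apply: H1; rewrite ?groupM ?mod4_1_mulN.
by apply/eqP/(mulgI h0); rewrite E h02.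
Qed.

Lemma perm_model_stab_mod4_3 G H h0 s : transversal_pair G H ->
  h0 \in H -> h0.1 = 1%R -> r h0 = (-1)%R ->
  (forall h, (h \in H) = (h == 1) || (h == h0)) ->
  s \in G -> s.1 = 0%R -> (r s * r s = 1)%R -> ~~ mod4_1 (r s) ->
  (forall s', s' \in G -> s'.1 = 0%R -> s' = 1 \/ s' = s) ->
  exists p, perm_model G H p.
Proof.
move=> [trG sHG iHG _] Hh0 E1 Rh0 HE Gs s0 ss Ns Suniq; have Nh0 := neg1_not_mod4_1 Rh0.
have [q Eq] := mod4_3P e_ge2 (mul_partU s) Ns.
have q8 : (8 * q = 0)%R.
  apply: (mulIr (Z2_odd_unit e_ge2 (- q)%R)).
  by rewrite Eq in ss; apply: (lincomb1 (-1)%R ss); ring.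
pose g := h0 * s.
have Gg : g \in G by rewrite groupM // (subsetP sHG).
have Eg : g.1 = 1%R by rewrite add_partM E1 s0 mul0r addr0.
have Rg : r g = (1 - 4 * q)%R by rewrite mul_partM Rh0 Eq; ring.
have regg : regular_elt g.
  by rewrite /regular_elt Eg unitr1; apply/mod4_1P; exists (- q)%R; rewrite Rg; ring.
(* Because 8q = 0, the unit of a power of g is affine in its first coordinate. Multiplying by s then
   gives the only other possible unit over a given point. *)
have powg i : r (g ^+ i) = (1 - 4 * q * (g ^+ i)%g.1)%R.
  elim: i => [|i IH]; first by rewrite expg0 mul_part1 add_part1; ring.
  rewrite expgS mul_partM add_partM IH Rg Eg.
  move: (g ^+ i).1 => v.
  by apply: (lincomb1 (0)%R q8); ring.
have Gform x : x \in G -> r x = (1 - 4 * q * x.1)%R \/ r x = (4 * q * (x.1 + 1) - 1)%R.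
  move=> Gx; have [i Ei] := regular_powers e_ge2 x.1 regg.
  have Gs' : (g ^+ i)^-1 * x \in G by rewrite groupM ?groupV ?groupX.
  have s'0 : ((g ^+ i)^-1 * x).1 = 0%R.
    by rewrite add_partM add_partV mul_partV Ei addrC subrr.
  have Ex : x = g ^+ i * ((g ^+ i)^-1 * x) by rewrite mulKVg.
  have [Es|Es] := Suniq _ Gs' s'0; rewrite Es in Ex; rewrite {1 3}Ex mul_partM powg Ei.
    by left; rewrite mul_part1 mulr1.
  right; rewrite Eq; apply: (lincomb1 (- 2 * q * x.1)%R q8); ring.
have mod1 x : mod4_1 (1 - 4 * q * x.1)%R.
  by apply/mod4_1P; exists (- q * x.1)%R; ring.
have mod3 x : r x = (4 * q * (x.1 + 1) - 1)%R -> ~~ mod4_1 (r x).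
  by move=> Ex; apply/(mod4_3P e_ge2 (mul_partU x)); exists (q * (x.1 + 1))%R; rewrite Ex; ring.
have Gf x : x \in G -> if mod4_1 (r x) then r x = (1 - 4 * q * x.1)%R
                       else r x = (4 * q * (x.1 + 1) - 1)%R.
  by move=> Gx; have [Ex|Ex] := Gform x Gx; [rewrite Ex mod1 | rewrite (negbTE (mod3 x Ex))].
(* G is dihedral, generated by g and s; f is the inverse of i |-> (g ^+ i).1. *)
pose f v : Z := (v - 2 * q * (v ^+ 2 - v))%R.
(* p sends g^i to the translation by i, and h0 to [0, -1] since f 1 = 1. *)
pose p x : hol e := if mod4_1 (r x) then mkhol (f x.1) 1%R else mkhol (f x.1 - 1)%R (-1)%R.
have N1u : (-1 : Z)%R \is a GRing.unit by rewrite unitrN1.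
exists p; split=> [x y Gx Gy|x Gx].
  have [j Ej] : exists j, (y.1 ^+ 2 - y.1 = 2 * j)%R.
    case: (Z2_parity y.1) => -[t ->]; [exists (2 * t ^+ 2 - t)%R | exists (2 * t ^+ 2 + t)%R]; ring.
  have add1 : r x = (1 - 4 * q * x.1)%R -> f (x * y).1 = (f x.1 + f y.1)%R.
    rewrite add_partM /f => ->; move: x.1 y.1 => v w.
    by apply: (lincomb1 (- v * w + 2 * q * v * w * (v + w) - 4 * q ^+ 2 * v ^+ 2 * w ^+ 2 - q * v * w)%R q8); ring.
  have add3 : r x = (4 * q * (x.1 + 1) - 1)%R -> f (x * y).1 = (f x.1 - f y.1)%R.
    rewrite add_partM /f => ->; move: x.1 y.1 Ej => v w Ej.
    by apply: (lincomb2 (v * w - j - 2 * q * w * (v + 1) * (v - w)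
                         - 4 * q ^+ 2 * w ^+ 2 * (v + 1) ^+ 2 + q * w * (v + 1))%R (- 4 * q)%R q8 Ej); ring.
  have := Gf x Gx; rewrite /p mul_partM mod4_1M //.
  case: (mod4_1 (r x)) => [/add1|/add3] Ef; case: (mod4_1 (r y));
    by apply: hol_eqP; rewrite ?(add_partM, mul_partM) ?mkhol2 ?unitr1 // ?mkhol1 -?add_partM ?Ef; ring.
have := Gf x Gx; rewrite /p HE; case: ifP => Mx Ex; rewrite mkhol1.
  have Ef : f x.1 = (x.1 * (1 + 2 * (- q * (x.1 - 1))))%R by rewrite /f; ring.
  have Uf := Z2_odd_unit e_ge2 (- q * (x.1 - 1))%R.
  rewrite Ef mulr_unit_eq0 //.
  have -> : (x == h0) = false by apply: contraTF Mx => /eqP->.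
  rewrite orbF; apply/eqP/eqP => [x0|->//].
  by apply: hol_eqP; rewrite // Ex x0 mul_part1; ring.
have Ef : (f x.1 - 1 = (x.1 - 1) * (1 + 2 * (- q * x.1)))%R by rewrite /f; ring.
have Uf := Z2_odd_unit e_ge2 (- q * x.1)%R.
rewrite Ef mulr_unit_eq0 //.
have -> : (x == 1) = false by apply: contraFF Mx => /eqP->; rewrite mod4_1_1.
rewrite /= subr_eq0; apply/eqP/eqP => [x1|->//].
by apply: hol_eqP; rewrite ?E1 // Ex Rh0 x1; apply: (lincomb1 1%R q8); ring.
Qed.

Lemma perm_model_stab_mod4_1 G H h0 : transversal_pair G H ->
  h0 \in H -> h0.1 = 1%R -> r h0 = (-1)%R ->
  (forall h, (h \in H) = (h == 1) || (h == h0)) ->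
  (forall x, x \in G -> 2 * (cmg h0 x).1 = 0)%R ->
  exists p, perm_model G H p.
Proof.
move=> [trG sHG iHG _] Hh0 E1 Rh0 HE cmgG.
pose m : Z := (2 ^+ e.-1)%R; have m2 : (2 * m = 0)%R := half_double e_ge2.
have mm : (m * m = 0)%R := half_sqr e_ge2.
have m0 : m != 0%R by rewrite /m Z2_exp2_eq0 //; nlia.
have Um : (1 + m)%R \is a GRing.unit.
  apply/(Z2_odd_unitE e_ge2); exists (2 ^+ e.-2)%R.
  by rewrite -exprS /m; congr (_ + _ ^+ _)%R; nlia.
(* Both r x - (1 - 2 x.1), which is 0 or m, and m x.1, the parity of x.1, are characters of G. Here
   [s] holds where they agree, so it fails on h0 and on [0, 1 + m], the two elements that p is to
   exchange. *)
pose s x := r x == (1 - 2 * x.1 + m * x.1)%R.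
have Gf x : x \in G -> if s x then r x = (1 - 2 * x.1 + m * x.1)%R
                       else r x = (1 - 2 * x.1 + m * (x.1 + 1))%R.
  move=> Gx; case: ifP => [/eqP //|/eqP Nx].
  have := cmgG x Gx; rewrite add_part_cmg E1 Rh0 => E.
  have /eqP : (2 * (r x - 1 + 2 * x.1) = 0)%R by apply: (lincomb1 (-1)%R E); ring.
  rewrite Z2_annihilator_val // !inE -/m => Ex.
  have {}Ex : (r x = 1 - 2 * x.1)%R \/ (r x = 1 - 2 * x.1 + m)%R.
    by case/orP: Ex => /eqP Ex; [left|right]; apply: (lincomb1 1%R Ex); ring.
  have [[t Et]|[t Et]] := Z2_parity x.1.
    have mt : (m * x.1 = 0)%R by rewrite Et; apply: (lincomb1 t m2); ring.
    case: Ex => Ex; first by case: Nx; rewrite Ex mt addr0.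
    by rewrite Ex mulrDr mt; ring.
  have mt : (m * x.1 = m)%R by rewrite Et; apply: (lincomb1 t m2); ring.
  case: Ex => Ex; last by case: Nx; rewrite Ex mt.
  by rewrite Ex mulrDr mt; apply: (lincomb1 (-1)%R m2); ring.
have sF x : r x = (1 - 2 * x.1 + m * (x.1 + 1))%R -> s x = false.
  move=> Ex; apply: contraNF m0 => /eqP; rewrite Ex => E.
  by apply/eqP; apply: (lincomb1 1%R E); ring.
have sM x y : x \in G -> y \in G -> s (x * y) = (s x == s y).
  move=> Gx Gy; have := Gf x Gx; have := Gf y Gy.
  case: (s x); case: (s y) => Ey Ex /=; [apply/eqP | apply: sF | apply: sF | apply/eqP];
    rewrite mul_partM add_partM Ex Ey; move: x.1 y.1 => v w.
  - by ring.
  - by apply: (lincomb2 v (- v)%R mm m2); ring.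
  - by ring.
  by apply: (lincomb2 (v + 1)%R (1 - v)%R mm m2); ring.
(* G is a central product of a cyclic group and the dihedral group of order 8
   generated by h0 = [1, -1] and [0, 1 + m]; p exchanges these two generators. *)
pose p x : hol e := if s x then mkhol (x.1 + m * x.1)%R (r x)
                    else mkhol (1 - x.1)%R (- (r x * (1 + m)))%R.
have Ur x : (- (r x * (1 + m)))%R \is a GRing.unit by rewrite unitrN unitrM Um mul_partU.
exists p; split=> [x y Gx Gy|x Gx].
  have := Gf x Gx; have := Gf y Gy; rewrite /p sM //.
  have Rx : FinRing.uval x.2 = r x by [].
  case: (s x); case: (s y) => Ey Ex /=; apply: hol_eqP;
    rewrite ?(mul_partM (mkhol _ _)) ?(add_partM (mkhol _ _)) !mkhol2 ?mul_partU // ?mkhol1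
      ?(mul_partM x y) ?(add_partM x y) ?Rx.
  - by rewrite Ex; move: x.1 y.1 => v w; ring.
  - by rewrite Ex; move: x.1 y.1 => v w; apply: (lincomb1 (- v)%R m2); ring.
  - by ring.
  - rewrite Ex; move: x.1 y.1 => v w.
    by apply: (lincomb2 (3 * w + m * v * w + m * w)%R (- 2 * v * w + w)%R mm m2); ring.
  - by ring.
  - by rewrite Ex; move: x.1 y.1 => v w; apply: (lincomb2 (v + 1)%R 1%R mm m2); ring.
  - by apply: (lincomb2 (- (r x * r y))%R (- (r x * r y))%R mm m2); ring.
have := Gf x Gx; rewrite /p HE; case: ifP => Mx Ex; rewrite mkhol1.
  have -> : (x.1 + m * x.1 = x.1 * (1 + m))%R by ring.
  have -> : (x == h0) = false.
    apply: contraTF Mx => /eqP->; rewrite /s Rh0 E1; apply: contraNN m0 => /eqP E.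
    by apply/eqP; apply: (lincomb1 (-1)%R E); ring.
  rewrite mulr_unit_eq0 // orbF; apply/eqP/eqP => [x0|->//].
  by apply: hol_eqP; rewrite // Ex x0 mul_part1; ring.
have -> : (x == 1) = false.
  by apply: contraFF Mx => /eqP->; rewrite /s mul_part1 add_part1; apply/eqP; ring.
rewrite subr_eq0 eq_sym; apply/eqP/eqP => [x1|->//].
by apply: hol_eqP; rewrite ?E1 // Ex Rh0 x1; apply: (lincomb1 1%R m2); ring.
Qed.

(** Conjugating by the unit h0.1 turns h0 into [1, -1]. The commutator condition is demanded only
    when the stabiliser is 1 mod 4; otherwise a model always exists. *)
Lemma perm_model_inverting G H h0 : transversal_pair G H ->
  h0 \in H -> h0.1 \is a GRing.unit -> r h0 = (-1)%R ->
  (forall h, h \in H -> mod4_1 (r h) -> h = 1) ->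
  ((forall x, x \in G -> x.1 = 0%R -> mod4_1 (r x)) ->
   forall x, x \in G -> 2 * (cmg h0 x).1 = 0)%R ->
  exists p, perm_model G H p.
Proof.
move=> tGH0 Hh00 Uu Rh00 H10 cm0; pose t : hol e := mkhol 0%R h0.1.
suff [p modp] : exists p, perm_model (G :^ t)%G (H :^ t)%G p.
  by exists (fun x => p (x ^ t)); apply: perm_modelJ modp.
have tGH := transversal_pairJ t tGH0.
have Hh0 : h0 ^ t \in (H :^ t)%G by rewrite memJ_conjg.
have E1 : (h0 ^ t).1 = 1%R by rewrite add_partJ_scale // divrr.
have Rh0 : r (h0 ^ t) = (-1)%R by rewrite mul_partJ.
have H1 h : h \in (H :^ t)%G -> mod4_1 (r h) -> h = 1.
  by case/imsetP => k Hk ->; rewrite mul_partJ => /(H10 k Hk) ->; rewrite conj1g.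
have HE := inverting_mem tGH Hh0 Rh0 H1.
have [_ [s [Gs s0 ss sN1 Suniq]]] := stab_generated tGH Hh0 Rh0 H1.
case: (boolP (mod4_1 (r s))) => [Ms|Ns]; last exact: (perm_model_stab_mod4_3 tGH Hh0 E1 Rh0 HE Gs s0).
apply: (perm_model_stab_mod4_1 tGH Hh0 E1 Rh0 HE) => _ /imsetP[x Gx ->].
have -> : cmg (h0 ^ t) (x ^ t) = (cmg h0 x) ^ t by rewrite /cmg !(conjMg, conjVg).
rewrite add_partJ_scale // mulrA cm0 ?mul0r // => y Gy y0.
have Gyt : y ^ t \in (G :^ t)%G by rewrite memJ_conjg.
have yt0 : (y ^ t).1 = 0%R by rewrite add_partJ_scale // y0 mul0r.
rewrite -(mul_partJ y t); have [->|->//] := Suniq _ Gyt yt0; exact: mod4_1_1.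
Qed.

(** The zero set is bounded in two directions: an x in it shares its unit with some h in H, and then
    h^-1 x is a translation in the zero set, hence trivial. *)
Lemma perm_model_generated G H f h1 p : transversal_pair G H ->
  {in G &, {morph p : x y / x * y}} -> f \in H -> h1 \in H ->
  (forall h, h \in H -> exists k, h = h1 ^+ k \/ h = f * h1 ^+ k) ->
  (p f).1 = 0%R -> (p h1).1 = 0%R ->
  (forall x, x \in G -> (p x).1 = 0%R -> exists2 h, h \in H & r h = r x) ->
  (forall u, transl u \in G -> (p (transl u)).1 = 0%R -> u = 0%R) ->
  perm_model G H p.
Proof.
move=> [trG sHG iHG _] pM Hf Hh1 genH pf ph1 prox ptr; split=> // x Gx.
have Gf := subsetP sHG _ Hf; have Gh1 := subsetP sHG _ Hh1.
have pH0 h : h \in H -> (p h).1 = 0%R.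
  have pX k : (p (h1 ^+ k)).1 = 0%R by rewrite (morph_pow _ pM) // add_partX ph1 mul0r.
  case/genH => k [->|->] //; rewrite (pM _ _ Gf (groupX k Gh1)).
  by rewrite add_partM pf pX mul0r addr0.
apply/eqP/idP => [px0|/pH0 //]; have [h Hh Er] := prox x Gx px0.
have Gh := subsetP sHG _ Hh; pose n := h^-1 * x.
have Rn : r n = 1%R by rewrite mul_partM mul_partV Er mulVr // mul_partU.
have Gn : n \in G by rewrite groupM ?groupV.
have pn : (p n).1 = 0%R.
  have := px0; have {1}-> : x = h * n by rewrite mulKVg.
  rewrite (pM _ _ Gh Gn) add_partM pH0 // add0r => /eqP.
  by rewrite mulr_unit_eq0 ?mul_partU // => /eqP.
have : n.1 = 0%R by apply: ptr; rewrite -(transl_eq Rn).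
move=> n0; have n1 : n = 1 by apply: hol_eqP.
by have -> : x = h by rewrite -[x](mulKVg h) -/n n1 mulg1.
Qed.
End TrivialMeet.

(** * H generated by phi_(-1) and an element over 2^(e-1) *)

Section Beta.
Context {e : nat} (e_ge2 : (2 <= e)%N).
Local Notation Z := 'Z_(2 ^ e).
Implicit Types (x y g h : hol e) (u v w a b : Z) (T G H X : {group hol e}) (p : hol e -> hol e).
Local Notation r := mul_part.

(** The projection of the units onto those that are 1 mod 4, along the factor {1, -1}. *)
Definition normal_part a : Z := if mod4_1 a then a else (- a)%R.

Lemma normal_partM x y : normal_part (r (x * y)) = (normal_part (r x) * normal_part (r y))%R.
Proof.
rewrite /normal_part mul_partM mod4_1M //.
by case: (mod4_1 (r x)); case: (mod4_1 (r y)); rewrite /= ?mulrN ?mulNr ?opprK.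
Qed.

(** The first coordinate vanishes on f but is 2^(e-1) on h1. With q 2^i = 2^(e-1), the term q
    ([normal_part] (r x) - 1) is 0 on f and 2^(e-1) on h1, so adding it kills both. The difficulty
    is to keep a crossed homomorphism when G has normal parts that are not 1 mod 2^i. *)
Lemma perm_model_neg1 G H f h1 i t : transversal_pair G H ->
  f \in H -> f.1 = 0%R -> r f = (-1)%R ->
  h1 \in H -> h1.1 = (2 ^+ e.-1)%R -> r h1 = (1 + 2 ^+ i * (1 + 2 * t))%R ->
  (2 <= i < e)%N ->
  (forall h, h \in H -> mod4_1 (r h) -> exists k, h = h1 ^+ k) ->
  exists p, perm_model G H p.
Proof.
move=> tGH Hf f0 Rf Hh1 h1m Rh1 /andP[i2 lt_ie] genH.
have [trG sHG iHG H1] := tGH; have Nf := neg1_not_mod4_1 e_ge2 Rf.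
have Gf := subsetP sHG _ Hf; have Gh1 := subsetP sHG _ Hh1.
have ff : f * f = 1.
  apply: H1; first exact: groupM.
  by rewrite mul_partM Rf; ring.
pose m : Z := (2 ^+ e.-1)%R; have m2 : (2 * m = 0)%R := half_double e_ge2.
have mm : (m * m = 0)%R := half_sqr e_ge2.
have genH' h : h \in H -> exists k, h = h1 ^+ k \/ h = f * h1 ^+ k.
  move=> Hh; case: (boolP (mod4_1 (r h))) => [/(genH h Hh)[k ->]|Nh]; first by exists k; left.
  have [|k Ek] := genH (f * h) (groupM Hf Hh); first by rewrite mod4_1_mulN.
  by exists k; right; rewrite -Ek mulgA ff mul1g.
have sgnh1 k : normal_part (r (h1 ^+ k)) = (r h1 ^+ k)%R.
  rewrite /normal_part mul_partX Rh1.
  suff -> : mod4_1 ((1 + 2 ^+ i * (1 + 2 * t)) ^+ k)%R by [].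
  elim: k => [|k IH]; first by rewrite expr0 mod4_1_1.
  rewrite exprS mod4_1M ?IH ?mod4_1_2X //; apply: mod4_1_unit => //; exact: mod4_1_2X.
have sgnf : normal_part (r f) = 1%R by rewrite /normal_part (negbTE Nf) Rf opprK.
(* Commutators with phi_(-1) yield all even translations. *)
have evenN u : transl (2 * u)%R \in G.
  have [g Gg Eg] : exists2 g, g \in G & g.1 = (- u)%R.
    by have /(transitive_add_part G)/(_ (- u)%R) := trG.
  have := in_cmg Gf Gg; rewrite (transl_eq (mul_part_cmg _ _)) add_part_cmg f0 Rf Eg.
  by congr (transl _ \in G); ring.
have Em : m = (2 * 2 ^+ e.-2)%R by rewrite -exprS /m; congr (_ ^+ _)%R; nlia.
have Hm h : h \in H -> exists w, h.1 = (m * w)%R.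
  case/genH' => k [->|->].
    by exists (geom (r h1) k); rewrite add_partX h1m.
  by exists (- geom (r h1) k)%R; rewrite add_partM add_partX h1m f0 Rf /m; ring.
(* Elements of H have even translation parts, so stripping these stays in G; by counting, this
   yields the whole stabiliser. *)
have stabH x : x \in G -> x.1 = 0%R -> exists2 h, h \in H & r h = r x.
  move=> Gx x0; pose phi h := transl (- h.1)%R * h.
  have Rphi h : r (phi h) = r h by rewrite mul_partM mul_part_transl mul1r.
  have phi_inj : {in H &, injective phi}.
    move=> h h' Hh Hh' /(congr1 mul_part); rewrite !Rphi => E.
    have : h^-1 * h' = 1.
      apply: H1; first by rewrite groupM ?groupV.
      by rewrite mul_partM mul_partV E mulVr // mul_partU.
    by move/(congr1 (mulg h)); rewrite mulKVg mulg1.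
  have sphi : phi @: H \subset hol_stab G.
    apply/subsetP => _ /imsetP[h Hh ->]; rewrite in_hol_stab.
    have -> : ((phi h).1 == 0)%R.
      by rewrite add_partM transl1 mul_part_transl mulr1 addNr.
    rewrite andbT groupM ?(subsetP sHG h Hh) //.
    have [w ->] := Hm h Hh; rewrite Em.
    by have := evenN (- (2 ^+ e.-2 * w))%R; congr (transl _ \in G); ring.
  have Ephi : phi @: H = hol_stab G.
    by apply/eqP; rewrite eqEcard sphi card_in_imset // (card_stab_eq e_ge2 tGH) leqnn.
  have : x \in hol_stab G by rewrite in_hol_stab Gx x0 /=.
  by rewrite -Ephi => /imsetP[h Hh ->]; exists h; rewrite ?Rphi.
have sgnH h : h \in H -> exists z, normal_part (r h) = (1 + 2 ^+ i * z)%R.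
  case/genH' => k [->|->]; exists ((1 + 2 * t) * geom (r h1) k)%R;
    rewrite ?normal_partM ?sgnf ?mul1r sgnh1 expr_geom {1}Rh1; ring.
have pow1 (z : Z) : exists k, (1 + 2 ^+ i * z = r (h1 ^+ k)%g)%R.
  by have [k Ek] := pow_generator e_ge2 t z i2; exists k; rewrite mul_partX Rh1.
have phiG a : (exists z, a = 1 + 2 ^+ i * z)%R -> exists2 s, s \in G & s.1 = 0%R /\ r s = a.
  case=> z ->; have [k ->] := pow1 z; have [w Ew] := Hm _ (groupX k Hh1).
  exists (transl (- (h1 ^+ k)%g.1)%R * h1 ^+ k).
    rewrite groupM ?groupX // Ew Em.
    by have := evenN (- (2 ^+ e.-2 * w))%R; congr (transl _ \in G); ring.
  by rewrite add_partM mul_partM transl1 mul_part_transl mulr1 mul1r addNr.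
(* The square of x has even translation part; stripped of it, it lies in the stabiliser. So (r x)^2
   is 1 mod 2^i, and r x loses at most one level. *)
have sqG x : x \in G -> mod4_1 (r x) -> exists y : Z, r x = (1 + 2 ^+ i.-1 * y)%R.
  move=> Gx Mx; have [s Es] := mod4_1P _ Mx.
  pose x2 := transl (- (x * x)%g.1)%R * (x * x).
  have Gx2 : x2 \in G.
    rewrite groupM ?groupM // add_partM Es.
    by have := evenN (- x.1 * (1 + 2 * s))%R; congr (transl _ \in G); ring.
  have x20 : x2.1 = 0%R by rewrite add_partM transl1 mul_part_transl mulr1 addNr.
  have Rx2 : r x2 = (r x * r x)%R by rewrite mul_partM mul_part_transl mul1r mul_partM.
  have [h Hh Eh] := stabH _ Gx2 x20; have [z Ez] := sgnH h Hh.
  have Mh : mod4_1 (r h) by rewrite Eh Rx2 mod4_1M // eqxx.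
  rewrite /normal_part Mh Eh Rx2 in Ez.
  have Us := Z2_odd_unit e_ge2 s.
  have Ei : (2 ^+ i = 2 * 2 ^+ i.-1 :> Z)%R by rewrite -exprS; congr (_ ^+ _)%R; nlia.
  have E2 : (2 * (r x - 1 - 2 ^+ i.-1 * (z / (1 + 2 * s))) == 0)%R.
    have Ew := divrK Us z; move: (z / _)%R Ew => w Ew.
    apply/eqP/(mulIr Us); rewrite Ei in Ez; rewrite Es in Ez *.
    by apply: (lincomb2 1%R (- 2 * 2 ^+ i.-1)%R Ez Ew); ring.
  rewrite Z2_annihilator_val // !inE in E2; case/orP: E2 => /eqP E.
    by exists (z / (1 + 2 * s))%R; apply: (lincomb1 1%R E); ring.
  exists (z / (1 + 2 * s) + 2 ^+ (e - i))%R.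
  have Ee : (2 ^+ e.-1 = 2 ^+ i.-1 * 2 ^+ (e - i) :> Z)%R.
    by rewrite -exprD; congr (_ ^+ _)%R; nlia.
  by rewrite Ee in E; apply: (lincomb1 1%R E); ring.
have toM x : x \in G -> exists x', [/\ x' \in G, x'.1 = x.1, mod4_1 (r x') & r x' = normal_part (r x)].
  move=> Gx; rewrite /normal_part; case: (boolP (mod4_1 (r x))) => [Mx|Nx]; first by exists x.
  exists (x * f); split; first exact: groupM.
  - by rewrite add_partM f0 mul0r addr0.
  - by rewrite mod4_1_mulN.
  by rewrite mul_partM Rf mulrN1.
have hwit x z : normal_part (r x) = (1 + 2 ^+ i * z)%R -> exists2 h, h \in H & r h = r x.
  have [k ->] := pow1 z; rewrite /normal_part; case: ifP => _ E.
    by exists (h1 ^+ k); rewrite ?groupX.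
  by exists (f * h1 ^+ k); rewrite ?groupM ?groupX // mul_partM Rf -E; ring.
pose q : Z := (2 ^+ (e.-1 - i))%R.
have qi : (q * 2 ^+ i = m)%R by rewrite -exprD subnK //; nlia.
(* If all normal parts are 1 mod 2^i, the correction takes only the values 0 and m, which every unit
   fixes, so it is additive and the character can stay unchanged. *)
case: (boolP [forall x in G, [exists z : Z, normal_part (r x) == 1 + 2 ^+ i * z]%R]).
  move/forall_inP => allx.
  have sx x : x \in G -> exists z, normal_part (r x) = (1 + 2 ^+ i * z)%R.
    by move=> Gx; have /existsP[z /eqP] := allx x Gx; exists z.
  pose p x := mkhol (x.1 + q * (normal_part (r x) - 1))%R (r x).
  have m2i : (m * 2 ^+ i = 0)%R.
    by rewrite -exprD Z2_exp2_ge //; nlia.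
  exists p; apply: (perm_model_generated tGH _ Hf Hh1 genH').
  - move=> x y Gx Gy; apply: hol_eqP; last first.
      by rewrite mul_partM /p !mkhol2 ?mul_partU // mul_partM.
    rewrite (add_partM (p x)) /p !mkhol1 mkhol2 ?mul_partU // normal_partM add_partM.
    have [z ->] := sx x Gx; have [z' ->] := sx y Gy.
    have [d ->] := Z2_unit_odd e_ge2 (mul_partU x).
    apply: (lincomb3 (z + z' + 2 ^+ i * z * z' - z - (1 + 2 * d) * z')%R (- d * z')%R (z * z')%R qi m2 m2i).
    by ring.
  - by rewrite /p mkhol1 sgnf f0 subrr mulr0 addr0.
  - have := sgnh1 1%N; rewrite expg1 expr1 /p mkhol1 h1m => ->; rewrite Rh1 -/m.
    by apply: (lincomb2 (1 + 2 * t)%R (1 + t)%R qi m2); ring.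
  - by move=> x Gx _; have [z /hwit] := sx x Gx.
  move=> u _; rewrite /p mkhol1 transl1 mul_part_transl /normal_part mod4_1_1 subrr mulr0.
  by rewrite addr0.
case/forall_inPn => x0 Gx0 Nx0.
have [x1 [Gx1 Ex1 Mx1 Sx1]] := toM x0 Gx0.
have {Nx0} Nx1 z : r x1 <> (1 + 2 ^+ i * z)%R.
  by move=> E; case/existsP: Nx0; exists z; rewrite -Sx1 E.
have i3 : (3 <= i)%N.
  rewrite ltn_neqAle i2 andbT; apply/eqP => Ei; have [s Es] := mod4_1P _ Mx1.
  by apply: (Nx1 s); rewrite Es -Ei; ring.
pose B : Z := (2 ^+ i.-1)%R; pose n : Z := (2 ^+ e.-2)%R.
have EB : (2 ^+ i = 2 * B :> Z)%R by rewrite -exprS; congr (_ ^+ _)%R; nlia.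
have qB : (q * B = n)%R by rewrite -exprD; congr (_ ^+ _)%R; nlia.
have n4 : (4 * n = 0)%R.
  have -> : (4 = 2 ^+ 2 :> Z)%R by ring.
  by rewrite -exprD Z2_exp2_ge //; nlia.
have nn : (n * n = 0)%R by rewrite -exprD Z2_exp2_ge //; nlia.
have nB : (n * B = 0)%R by rewrite -exprD Z2_exp2_ge //; nlia.
have [n' En] : exists n', n = (2 * n')%R.
  by exists (2 ^+ (e - 3))%R; rewrite -exprS /n; congr (_ ^+ _)%R; nlia.
(* A mismatch would give the stabiliser a normal part that is not 1 mod 2^i. If only z is odd, strip
   the even translation from y. If only y.1 is odd, stripping the unit gives an odd translation, so
   N lies in G and [x1] can be stripped. *)
have parity x z : x \in G -> normal_part (r x) = (1 + B * z)%R -> exists k, x.1 = (z + 2 * k)%R.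
  move=> Gx; have [y [Gy <- My <-]] := toM x Gx => {x Gx} Ey.
  have [[w Ew]|[w Ew]] := Z2_parity z; have [[k Ek]|[k Ek]] := Z2_parity y.1.
  - by exists (k - w)%R; rewrite Ek Ew; ring.
  - exfalso.
    have [|s Gs [s0 Rs]] := phiG (r y).
      by exists w; rewrite Ey Ew EB; ring.
    pose c := y * s^-1.
    have Rc : r c = 1%R by rewrite mul_partM mul_partV Rs divrr // mul_partU.
    have c1 : c.1 = y.1 by rewrite add_partM add_partV s0 mul0r oppr0 mul0r addr0.
    have Gc : c \in G by rewrite groupM ?groupV.
    have Uy : y.1 \is a GRing.unit by rewrite Ek Z2_odd_unit.
    have GN u : transl u \in G.
      have [j Ej] : exists j : nat, (y.1 * j%:R = u)%R.
        by exists (val (u / y.1)%R); rewrite Z2_val_natr mulrC divrK.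
      by rewrite -Ej -translX groupX // -c1 -(transl_eq Rc).
    pose d := transl (- x1.1)%R * x1.
    have Gd : d \in G by rewrite groupM.
    have [|h Hh Eh] := stabH d Gd.
      by rewrite add_partM transl1 mul_part_transl mulr1 addNr.
    have [z' Ez'] := sgnH h Hh; apply: (Nx1 z'); rewrite -Ez' Eh.
    by rewrite mul_partM mul_part_transl mul1r /normal_part Mx1.
  - exfalso; pose d := transl (- y.1)%R * y.
    have Gd : d \in G.
      by rewrite groupM // Ek; have := evenN (- k)%R; congr (transl _ \in G); ring.
    have [|h Hh Eh] := stabH d Gd.
      by rewrite add_partM transl1 mul_part_transl mulr1 addNr.
    have [z' Ez'] := sgnH h Hh.
    have Ed : (1 + B * z = 1 + 2 ^+ i * z')%R.
      by rewrite -Ez' Eh mul_partM mul_part_transl mul1r -Ey /normal_part My.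
    have lt_i : (i.-1 < e)%N by nlia.
    have /negP[] := Z2_exp2_odd e_ge2 (w - z')%R lt_i; apply/eqP.
    rewrite EB Ew in Ed; rewrite -/B.
    by apply: (lincomb1 1%R Ed); ring.
  by exists (k - w)%R; rewrite Ek Ew; ring.
have sx x : x \in G -> exists z k, normal_part (r x) = (1 + B * z)%R /\ x.1 = (z + 2 * k)%R.
  move=> Gx; have [y [Gy _ My Ey]] := toM x Gx; have [z Ez] := sqG y Gy My.
  have Ez' : normal_part (r x) = (1 + B * z)%R by rewrite -Ey Ez.
  by have [k Ek] := parity x z Gx Ez'; exists z, k.
have qz z : (q * (1 + B * z - 1) = n * z)%R.
  by apply: (lincomb1 z qB); ring.
have U2n : (1 + 2 * n)%R \is a GRing.unit by apply: Z2_odd_unit.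
(* Here z mod 4 is a logarithm of normal_part (r x), so adding n * (z - x.1) to x.1
   kills h1; the twist of the character by 1 + 2 * n makes this a crossed homomorphism. *)
pose chi a : Z := if mod4_1 a then a else (a * (1 + 2 * n))%R.
have Uchi x : chi (r x) \is a GRing.unit.
  by rewrite /chi; case: ifP; rewrite ?unitrM ?U2n mul_partU.
pose p x := mkhol (x.1 * (1 - n) + q * (normal_part (r x) - 1))%R (chi (r x)).
exists p; apply: (perm_model_generated tGH _ Hf Hh1 genH').
- move=> x y Gx Gy; apply: hol_eqP; last first.
    rewrite mul_partM /p !mkhol2 ?Uchi // /chi mul_partM mod4_1M //.
    case: (mod4_1 (r x)); case: (mod4_1 (r y)); rewrite /=; try ring.
    by apply: (lincomb2 (- 4 * r x * r y)%R (- r x * r y)%R nn n4); ring.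
  rewrite (add_partM (p x)) /p !mkhol1 mkhol2 ?Uchi // normal_partM add_partM.
  have [z [k [Ez Ek]]] := sx x Gx; have [z' [k' [Ez' Ek']]] := sx y Gy.
  have EE : ((1 + B * z) * (1 + B * z') = 1 + B * (z + z' + B * z * z'))%R by ring.
  rewrite Ez Ez' EE !qz; move: Ez; rewrite /normal_part /chi.
  case: ifP => _ Ez; first by rewrite Ez; ring.
  have -> : r x = (- (1 + B * z))%R by rewrite -Ez opprK.
  rewrite Ek'; move: x.1 => u.
  apply: (lincomb3 (- 4 * B * k' * z - 4 * k')%R (4 * z' * z + 4 * k' * z)%R (z' + k')%R nn nB n4).
  by ring.
- by rewrite /p mkhol1 sgnf f0 subrr mulr0 mul0r addr0.
- have := sgnh1 1%N; rewrite expg1 expr1 /p mkhol1 h1m => ->; rewrite Rh1 -/m.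
  have mn : (m * n = 0)%R by rewrite Em -/n; apply: (lincomb1 2%R nn); ring.
  by apply: (lincomb3 (1 + 2 * t)%R (1 + t)%R (- 1)%R qi m2 mn); ring.
- move=> x Gx; have [z [k [Ez Ek]]] := sx x Gx.
  rewrite /p mkhol1 Ez qz Ek => E0.
  have [[w Ew]|[w Ew]] := Z2_parity z.
    by apply: (hwit x w); rewrite Ez Ew EB; ring.
  have /negP[] := Z2_odd_neq_even e_ge2 (w + k)%R (n' * (2 * k))%R.
  apply/eqP; rewrite Ew En in E0.
  by apply: (lincomb1 1%R E0); ring.
move=> u _; rewrite /p mkhol1 transl1 mul_part_transl /normal_part mod4_1_1 subrr mulr0 addr0.
move/eqP; rewrite mulr_unit_eq0 => [/eqP//|].
by rewrite En; apply/(Z2_odd_unitE e_ge2); exists (- n')%R; ring.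
Qed.
End Beta.

(** * Normal forms of H up to conjugation *)

Section Reduction.
Context {e : nat} (e_ge2 : (2 <= e)%N).
Local Notation Z := 'Z_(2 ^ e).
Implicit Types (x y g h : hol e) (u v w a b : Z) (T G H X : {group hol e}) (p : hol e -> hol e).
Local Notation r := mul_part.

(** Units of the form 1 + 2^i * odd generate all units 1 mod 2^i, so the least i occurring in H
    works, [mul_part] being injective there. The identity counts under i = e, so a minimum
    exists. *)
Lemma mod4_1_generator G H : transversal_pair G H ->
  exists i h1 (t : Z), [/\ h1 \in H, (2 <= i <= e)%N,
    r h1 = (1 + 2 ^+ i * (1 + 2 * t))%R
  & forall h, h \in H -> mod4_1 (r h) -> exists k, h = h1 ^+ k].
Proof.
case=> _ _ _ H1.
pose P i := (2 <= i)%N && [exists h in H, [exists t : Z, r h == 1 + 2 ^+ i * (1 + 2 * t)]%R].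
have exP : exists i, P i.
  exists e; rewrite /P e_ge2; apply/exists_inP; exists 1; first exact: group1.
  by apply/existsP; exists 0%R; rewrite Z2_exp2e // mul0r addr0 mul_part1.
case: (ex_minnP exP) => i /andP[i2 /exists_inP[h1 Hh1 /existsP[t /eqP Rh1]]] mini.
exists i, h1, t; split=> //.
  rewrite i2 mini //= /P e_ge2; apply/exists_inP; exists 1; first exact: group1.
  by apply/existsP; exists 0%R; rewrite Z2_exp2e // mul0r addr0 mul_part1.
move=> h Hh Mh; have [j [s /andP[j2 _] Eh]] := mod4_1_factor e_ge2 Mh.
have le_ij : (i <= j)%N.
  by apply: mini; rewrite /P j2; apply/exists_inP; exists h => //; apply/existsP; exists s; apply/eqP.
have [k Ek] := pow_generator e_ge2 t (2 ^+ (j - i) * (1 + 2 * s))%R i2.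
exists k; have : h1 ^- k * h = 1.
  apply: H1; first by rewrite groupM ?groupV ?groupX.
  rewrite mul_partM mul_partV mul_partX Rh1 -Ek mulrA -exprD subnKC // -Eh.
  by rewrite mulVr // mul_partU.
by move/(congr1 (mulg (h1 ^+ k))); rewrite mulKVg mulg1.
Qed.

(** h1^(2^(e-i)) has unit 1, hence is 1. Its first coordinate is an odd multiple of 2^(e-i) h1.1, so
    2^i divides h1.1. Conjugating by the translation by -y then moves h1 into Aut(N). *)
Lemma generator_coboundary G H h1 i t : transversal_pair G H ->
  h1 \in H -> (2 <= i <= e)%N -> r h1 = (1 + 2 ^+ i * (1 + 2 * t))%R ->
  exists y : Z, h1.1 = (y * (r h1 - 1))%R.
Proof.
case=> _ _ _ H1 Hh1 /andP[i2 le_ie] Rh1.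
have M1 : mod4_1 (r h1) by rewrite Rh1 mod4_1_2X.
have [s [E1 E2]] := hol_pow_mod4_1 e_ge2 (e - i) M1.
have Ee : (2 ^+ i * 2 ^+ (e - i) = 0 :> Z)%R by rewrite -exprD subnKC // Z2_exp2e.
have h11 : h1 ^+ (2 ^ (e - i)) = 1.
  apply: H1; first exact: groupX.
  by rewrite E2 Rh1; apply: (lincomb1 ((1 + 2 * t) * (1 + 2 * s))%R Ee); ring.
have z0 : (2 ^+ (e - i) * h1.1 = 0)%R.
  apply: (mulIr (Z2_odd_unit e_ge2 s)); rewrite mul0r -[RHS](congr1 fst h11) E1; ring.
have [w Ew] := Z2_annihilator e_ge2 (leq_subr i e) z0.
rewrite subKn // in Ew; have Ut := Z2_odd_unit e_ge2 t.
exists (w / (1 + 2 * t))%R; have Eq := divrK Ut w; move: (w / _)%R Eq => c Eq.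
by rewrite Ew Rh1 -Eq; ring.
Qed.

Definition inverting_pair H := exists2 h0, h0 \in H &
  [/\ h0.1 \is a GRing.unit, r h0 = (-1)%R
    & forall h, h \in H -> mod4_1 (r h) -> h = 1].

(** If H has an element h0 that is 3 mod 4, it commutes with h1 and its square is a power of h1;
    this gives [E1] and [E2]. For odd h0.1 they force units 1 and -1, the inverting pair. For h0.1 =
    2x', the product x' (r h1 - 1) is 0, and a translation kills both first coordinates, or 2^(e-1),
    the case of [perm_model_neg1]. *)
Lemma model_or_inverting_split G H h1 i t : transversal_pair G H ->
  h1 \in H -> h1.1 = 0%R -> (2 <= i <= e)%N ->
  r h1 = (1 + 2 ^+ i * (1 + 2 * t))%R ->
  (forall h, h \in H -> mod4_1 (r h) -> exists k, h = h1 ^+ k) ->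
  (exists p, perm_model G H p) \/ inverting_pair H.
Proof.
move=> tGH Hh1 h10 /andP[i2 le_ie] Rh1 gen; have [trG sHG iHG H1] := tGH.
have pow0 k : (h1 ^+ k).1 = 0%R by rewrite add_partX h10 mul0r.
case: (boolP [forall h in H, mod4_1 (r h)]) => [/forall_inP allM|].
  left; exists id; apply: (perm_model_id e_ge2 tGH) => h Hh.
  by have [k ->] := gen h Hh (allM h Hh).
case/forall_inPn => h0 Hh0 N0.
have [s Es] := mod4_3P e_ge2 (mul_partU h0) N0.
have genN h : h \in H -> ~~ mod4_1 (r h) -> exists k, h = h0^-1 * h1 ^+ k.
  move=> Hh Nh; have [|k Ek] := gen (h0 * h) (groupM Hh0 Hh); first by rewrite mod4_1_mulN.
  by exists k; rewrite -Ek mulKg.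
have E1 : (h0.1 * (r h1 - 1) = 0)%R.
  have := congr1 fst (H1 _ (in_cmg Hh0 Hh1) (mul_part_cmg _ _)).
  by rewrite add_part_cmg h10 add_part1 => E; apply: (lincomb1 (-1)%R E); ring.
have E2 : (h0.1 * (4 * s) = 0)%R.
  have [|k Ek] := gen (h0 * h0) (groupM Hh0 Hh0); first by rewrite mod4_1_mulN.
  have := pow0 k; rewrite -Ek add_partM Es => E.
  by apply: (lincomb1 1%R E); ring.
have [[x' Ex]|[x' Ex]] := Z2_parity h0.1; last first.
  right; exists h0 => //; have U0 := Z2_odd_unit e_ge2 x'; rewrite -Ex in U0.
  have R1 : (r h1 - 1 = 0)%R by apply: (mulrI U0); rewrite E1 mulr0.
  have s0 : (4 * s = 0)%R by apply: (mulrI U0); rewrite E2 mulr0.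
  split=> //; first by rewrite Es s0 sub0r.
  move=> h Hh Mh; apply: (H1 h Hh); have [k ->] := gen h Hh Mh.
  by rewrite mul_partX; move/eqP: R1; rewrite subr_eq0 => /eqP->; rewrite expr1n.
left.
have /eqP d2 : (2 * (x' * (r h1 - 1)) = 0)%R by rewrite -E1 Ex; ring.
rewrite Z2_annihilator_val // !inE in d2; case/orP: d2 => /eqP d0.
  have U0 : (2 * s - 1)%R \is a GRing.unit.
    by apply/(Z2_odd_unitE e_ge2); exists (s - 1)%R; ring.
  (* c solves 2x' + c (r h0 - 1) = 0, where r h0 - 1 = 2(2s - 1). *)
  have Ey := divrK U0 (- x')%R; set c := (- x' / (2 * s - 1))%R in Ey.
  suff [p modp] : exists p, perm_model (G :^ transl c)%G (H :^ transl c)%G p.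
    by exists (fun x => p (x ^ transl c)); apply: perm_modelJ modp.
  have tGHc := transversal_pairJ (transl c) tGH.
  exists id; apply: (perm_model_id e_ge2 tGHc) => _ /imsetP[h Hh ->].
  have h1c : (h1 ^ transl c).1 = 0%R.
    rewrite (add_partJ_transl h1 c) h10 add0r.
    apply: (mulIr U0); rewrite mul0r mulrAC Ey.
    by rewrite mulNr d0 oppr0.
  have powc k : ((h1 ^ transl c) ^+ k).1 = 0%R by rewrite add_partX h1c mul0r.
  have h0c : (h0 ^ transl c).1 = 0%R.
    rewrite (add_partJ_transl h0 c) Ex Es.
    by apply: (lincomb1 2%R Ey); ring.
  case: (boolP (mod4_1 (r h))) => [/(gen h Hh)|/(genN h Hh)] [k ->].
    by rewrite conjXg powc.
  by rewrite conjMg conjXg conjVg add_partM powc mul0r addr0 add_partV h0c mul0r oppr0.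
have m0 : (2 ^+ e.-1 != 0 :> Z)%R by rewrite Z2_exp2_eq0 //; nlia.
have lt_ie : (i < e)%N.
  rewrite ltn_neqAle le_ie andbT; apply/eqP => Ei; case/eqP: m0.
  by rewrite -d0 Rh1 Ei Z2_exp2e //; ring.
have m2 := half_double e_ge2.
have Ut := Z2_odd_unit e_ge2 t.
have xi2 : (2 * (2 ^+ i * x') = 0)%R.
  by apply: (mulIr Ut); rewrite Rh1 in d0; apply: (lincomb2 2%R 1%R d0 m2); ring.
have xi : (2 ^+ i * x' = 2 ^+ e.-1)%R.
  by rewrite Rh1 in d0; apply: (lincomb2 1%R (- t)%R d0 xi2); ring.
(* Divisibility of 4s by 2^i lets a power of h1 correct the unit of h0 to exactly -1; a smaller
   power of 2 in 4s would give 2^i x' = 0 by [E2]. *)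
have [c Ec] : exists c, (4 * s = 2 ^+ i * c)%R.
  have [j [w le_je Ej]] := Z2_factor e_ge2 (4 * s)%R.
  have [le_ij|lt_ji] := leqP i j.
    by exists (2 ^+ (j - i) * (1 + 2 * w))%R; rewrite Ej mulrA -exprD subnKC.
  case/eqP: m0; rewrite -xi; have Uw := Z2_odd_unit e_ge2 w.
  have z : (2 ^+ j.+1 * x' = 0)%R.
    apply: (mulIr Uw); rewrite Ex Ej in E2; rewrite exprS.
    by apply: (lincomb1 1%R E2); ring.
  have -> : (2 ^+ i = 2 ^+ (i - j.+1) * 2 ^+ j.+1 :> Z)%R by rewrite -exprD subnK.
  by rewrite -mulrA z mulr0.
have [k Ek] := pow_generator e_ge2 t (- c)%R i2.
pose f0 := h0 * h1 ^- k.
have Hf0 : f0 \in H by rewrite groupM ?groupV ?groupX.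
have f01 : f0.1 = (2 * x')%R by rewrite add_partM add_partV pow0 mul0r oppr0 mul0r addr0.
have Rf0 : r f0 = (-1)%R.
  rewrite mul_partM mul_partV mul_partX Rh1 -Ek.
  have -> : r h0 = (- (1 + 2 ^+ i * - c))%R by rewrite Es Ec; ring.
  rewrite mulNr divrr // Ek unitrX // mod4_1_unit // mod4_1_2X //.
suff [p modp] : exists p, perm_model (G :^ transl x')%G (H :^ transl x')%G p.
  by exists (fun x => p (x ^ transl x')); apply: perm_modelJ modp.
have tGHc := transversal_pairJ (transl x') tGH.
apply: (@perm_model_neg1 e e_ge2 _ _ (f0 ^ transl x') (h1 ^ transl x') i t tGHc).
- by rewrite memJ_conjg.
- by rewrite (add_partJ_transl f0 x') f01 Rf0; ring.
- by rewrite mul_partJ.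
- by rewrite memJ_conjg.
- by rewrite (add_partJ_transl h1 x') h10 d0 add0r.
- by rewrite mul_partJ.
- by rewrite i2.
move=> _ /imsetP[h Hh ->]; rewrite mul_partJ => /(gen h Hh)[j ->].
by exists j; rewrite conjXg.
Qed.

Lemma model_or_inverting G H : transversal_pair G H ->
  (exists p, perm_model G H p) \/ inverting_pair H.
Proof.
move=> tGH; have [i [h1 [t [Hh1 le_i Rh1 gen]]]] := mod4_1_generator tGH.
have [c Ec] := generator_coboundary tGH Hh1 le_i Rh1.
pose z : hol e := transl (- c)%R.
have tGHz := transversal_pairJ z tGH.
have Hz : h1 ^ z \in (H :^ z)%G by rewrite memJ_conjg.
have h1z : (h1 ^ z).1 = 0%R by rewrite (add_partJ_transl h1 (- c)%R) Ec; ring.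
have Rz : r (h1 ^ z) = (1 + 2 ^+ i * (1 + 2 * t))%R by rewrite mul_partJ.
have genz h : h \in (H :^ z)%G -> mod4_1 (r h) -> exists k, h = (h1 ^ z) ^+ k.
  case/imsetP => k Hk ->; rewrite mul_partJ => /(gen k Hk)[j ->].
  by exists j; rewrite conjXg.
case: (model_or_inverting_split tGHz Hz h1z le_i Rz genz) => [[p modp]|].
  by left; exists (fun x => p (x ^ z)); apply: perm_modelJ modp.
case=> _ /imsetP[h0 Hh0 ->] [U0 R0 H1].
right; exists h0 => //; rewrite mul_partJ in R0; split=> //.
  move: U0; rewrite (add_partJ_transl h0 (- c)%R) R0.
  have -> : (h0.1 + - c * (-1 - 1) = h0.1 + 2 * c)%R by ring.
  by rewrite Z2_unitD2.
move=> h Hh Mh; have : h ^ z = 1 by apply: H1; rewrite ?mul_partJ // memJ_conjg.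
by move/(canRL (conjgK z)); rewrite conj1g.
Qed.

End Reduction.

(** * Translation to the stated conditions *)

Section Final.
Context {e : nat} (e_ge2 : (2 <= e)%N).
Local Notation Z := 'Z_(2 ^ e).
Implicit Types (x y g h : hol e) (a b : Z) (T G H X : {group hol e}) (p : hol e -> hol e).
Local Notation r := mul_part.

Lemma holE_parts (u a : int) : ((a%:~R : Z) \is a GRing.unit)%R ->
  (holE e u a).1 = (u%:~R)%R /\ r (holE e u a) = (a%:~R)%R.
Proof. by move=> Ua; split=> //; rewrite /holE; exact: (mkhol2 _ Ua). Qed.

Lemma intr_odd_unit (u : int) : ((u%:~R : Z) \is a GRing.unit)%R = ~~ (2 %| u)%Z.
Proof.
have E : u = ((u %/ 2)%Z * 2 + (u %% 2)%Z)%R := divz_eq u 2.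
have Em : (u%:~R = (u %% 2)%Z%:~R + 2 * (u %/ 2)%Z%:~R :> Z)%R.
  by rewrite {1}E intrD intrM; ring.
rewrite Em Z2_unitD2 // (sameP dvdz_mod0P eqP).
have : ((u %% 2)%Z == 0%R) || ((u %% 2)%Z == 1%R) by nlia.
by case/orP => /eqP ->; rewrite ?unitr1 // unitr0.
Qed.

Lemma commutators_half G x y : #|[~: G, G]| <= 2 -> x \in G -> y \in G ->
  (2 * (cmg x y).1 = 0)%R.
Proof.
move=> c2 Gx Gy; have Ec : cmg x y = [~ x^-1, y^-1].
  by rewrite /cmg /commg /conjg !invgK invMg !mulgA.
have Dc : cmg x y \in [~: G, G] by rewrite Ec mem_commg ?groupV.
have : #[cmg x y] <= 2.
  by rewrite (leq_trans _ c2) // dvdn_leq ?cardG_gt0 // order_dvdG.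
have : 0 < #[cmg x y] by exact: order_gt0.
move=> o0 o2; have : cmg x y ^+ 2 = 1.
  apply/eqP; rewrite -order_dvdn; move: o0 o2.
  by case: #[cmg x y] => [|[|[|]]].
move/(congr1 fst); rewrite expgS expg1 add_partM mul_part_cmg mulr1 add_part1 => E.
by rewrite -[RHS]E; ring.
Qed.

Lemma derived_sub_holN G : [~: G, G] \subset G :&: holN e.
Proof.
rewrite -[G :&: holN e]/(gval (G :&: holN_group)%G) gen_subG.
apply/subsetP => _ /imset2P[x y Gx Gy ->].
have -> : [~ x, y] = cmg x^-1 y^-1 by rewrite /cmg invMg !invgK /commg /conjg mulgA.
by rewrite inE in_cmg ?groupV //= in_holN mul_part_cmg.
Qed.

Lemma inverting_stab G H : transversal_pair G H -> inverting_pair H ->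
  (forall x, x \in G -> x.1 = 0%R -> mod4_1 (r x)) ->
  [/\ exists2 u : int, ~~ (2 %| u)%Z & H :=: <[holE e u (-1)%R]>,
      #|G| = (2 ^ e.+1)%N
    & hol_stab G = <[holE e 0%R (1 + 2 ^ e.-1)%N%:Z]>].
Proof.
move=> tGH [h0 Hh0 [U0 R0 H1]] stabM; have [trG sHG iHG _] := tGH.
have [cH [s [Gs s0 ss sN1 Suniq]]] := stab_generated e_ge2 tGH Hh0 R0 H1.
split.
- have Eu : ((Posz (val h0.1))%:~R = h0.1 :> Z)%R by rewrite -[RHS]Z2_val_natr.
  exists (Posz (val h0.1)); first by rewrite -intr_odd_unit Eu.
  have N1 : (((-1 : int)%R)%:~R : Z)%R = (-1)%R by rewrite rmorphN1.
  have [|E1 E2] := @holE_parts (Posz (val h0.1)) (-1)%R; first by rewrite N1 unitrN1.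
  have -> : holE e (Posz (val h0.1)) (-1)%R = h0.
    by apply: hol_eqP; rewrite ?E1 ?E2 ?N1 ?R0 ?Eu.
  apply/eqP; rewrite eq_sym eqEcard cycle_subG Hh0 cH /= -orderE.
  rewrite ltnNge; apply/negP => o1.
  have : h0 = 1 by apply/eqP; rewrite -order_eq1 eqn_leq o1 order_gt0.
  by move=> h01; move: U0; rewrite h01 unitr0.
- by rewrite -(Lagrange sHG) cH iHG expnS.
have m0 : (2 ^+ e.-1 != 0 :> Z)%R by rewrite Z2_exp2_eq0 //; nlia.
have Rs : r s = (1 + 2 ^+ e.-1)%R.
  have [c Ec] := mod4_1P _ (stabM s Gs s0).
  have : (2 * (r s - 1) == 0)%R.
    apply/eqP/(mulIr (Z2_odd_unit e_ge2 c)); rewrite Ec in ss *.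
    by apply: (lincomb1 1%R ss); ring.
  rewrite Z2_annihilator_val // !inE => /orP[]; first by rewrite subr_eq0 (negbTE sN1).
  by move/eqP => E; apply: (lincomb1 1%R E); ring.
have Em : ((1 + 2 ^ e.-1)%N%:Z%:~R = 1 + 2 ^+ e.-1 :> Z)%R.
  by rewrite -natrX -[(_%:~R)%R]/((1 + 2 ^ e.-1)%:R)%R natrD.
have [|E1 E2] := @holE_parts 0%R (1 + 2 ^ e.-1)%N%:Z; first by rewrite Em -Rs mul_partU.
have -> : holE e 0%R (1 + 2 ^ e.-1)%N%:Z = s.
  by apply: hol_eqP; rewrite ?E1 ?E2 ?Em ?Rs ?s0.
apply/eqP; rewrite eq_sym eqEcard cycle_subG in_hol_stab Gs s0 eqxx /=.
rewrite (card_stab_eq e_ge2 tGH) cH -orderE ltnNge; apply/negP => o1.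
have : s = 1 by apply/eqP; rewrite -order_eq1 eqn_leq o1 order_gt0.
by move=> s1; case/eqP: sN1; rewrite s1.
Qed.

Lemma no_model_cycle G H p (u : int) : hol_transitive G -> H \subset G ->
  #|G : H| = (2 ^ e)%N -> #|H :&: holN e| = 1%N ->
  ~~ (2 %| u)%Z -> H :=: <[holE e u (-1)%R]> ->
  hol_stab G = <[holE e 0%R (1 + 2 ^ e.-1)%N%:Z]> ->
  (8 <= #|G :&: holN e| \/ #|[~: G, G]| = 4) -> ~ perm_model G H p.
Proof.
move=> trG sHG iHG c1 Ou EH ES cG.
have N1 : (((-1 : int)%R)%:~R : Z)%R = (-1)%R by rewrite rmorphN1.
have [|E1 E2] := @holE_parts u (-1)%R; first by rewrite N1 unitrN1.
apply: (no_model_inverting e_ge2 sHG iHG trG c1 (h := holE e u (-1)%R)) => //.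
- by rewrite EH cycle_id.
- by rewrite E1 intr_odd_unit.
move=> x Gx x0; have : x \in hol_stab G by rewrite in_hol_stab Gx x0 /=.
have Em : ((1 + 2 ^ e.-1)%N%:Z%:~R = 1 + 2 ^+ e.-1 :> Z)%R.
  by rewrite -natrX -[(_%:~R)%R]/((1 + 2 ^ e.-1)%:R)%R natrD.
have [|_ F2] := @holE_parts 0%R (1 + 2 ^ e.-1)%N%:Z.
  rewrite Em; apply/(Z2_odd_unitE e_ge2); exists (2 ^+ e.-2)%R.
  by rewrite -exprS; congr (_ + _ ^+ _)%R; nlia.
rewrite ES => /cycleP[k ->]; rewrite mul_partX F2 Em expr_geom.
by apply: (lincomb1 (geom (1 + 2 ^+ e.-1)%R k) (half_double e_ge2)); ring.
Qed.
End Final.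

Unset Implicit Arguments.

Theorem theorem1p6 (e : nat) (he : 2 <= e) (G H : {group hol e}) :
  hol_transitive G ->
  H \subset G -> #|G : H| = (2 ^ e)%N ->
  let C := gcore H G in
  (~ exists (T : {group hol e}) (f : {morphism (G / C) >-> hol e}),
        [/\ hol_transitive T, isom (G / C) T f & f @* (H / C) = hol_stab T])
  <->
  [\/ 4 <= #|H :&: holN e|,
      #|H :&: holN e| = 2%N /\ ~ (exists2 g, g \in G & #[g] = (2 ^ e)%N),
      #|H :&: holN e| = 2%N /\ ~ (H <| G)
    | [/\ #|H :&: holN e| = 1%N,
          exists2 u : int, ~~ (2 %| u)%Z & H :=: <[holE e u (-1)%R]>,
          #|G| = (2 ^ e.+1)%N,
          hol_stab G = <[holE e 0%R (1 + 2 ^ e.-1)%N%:Z]>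
        & 8 <= #|G :&: holN e| \/
          (#|G :&: holN e| = 4%N /\ #|[~: G, G]| = 4)]].
Proof.
move=> trG sHG iHG C; rewrite (perm_modelP he sHG iHG).
split=> [noM|alt [p modp]]; last first.
  case: alt => [c4|[c2 noG]|[c2 nnH]|[c1 [u Ou EH] _ ES cG]].
  - exact: (no_model_card4 he sHG iHG c4 modp).
  - have c2' : (2 <= #|H :&: holN e|)%N by rewrite c2.
    apply: (no_model_no_regular he sHG iHG c2' _ modp) => x Gx.
    by apply/negP => /(order_regularP he) ox; apply: noG; exists x.
  - exact: (no_model_not_normal he sHG iHG c2 nnH modp).
  apply: (no_model_cycle he trG sHG iHG c1 Ou EH ES _ modp).
  by case: cG => [|[_]]; [left|right].
have [k le_ke ck] := card_meet_holN he H.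
have [k2|k2] := leqP 2 k; first by apply: Or41; rewrite ck (@leq_exp2l 2 2).
have k01 : k = 0%N \/ k = 1%N by nlia.
case: k01 => [k0|k1]; last first.
  rewrite k1 expn1 in ck.
  case: (boolP [exists g in G, #[g] == 2 ^ e]%N) => [/exists_inP[g Gg /eqP og]|noG].
    case: (boolP (H <| G)) => [nHG|nnH]; last by apply: Or43; split=> //; apply/negP.
    by case: noM; apply: (perm_model_normal he nHG iHG ck Gg og).
  apply: Or42; split=> // -[g Gg og]; case/exists_inP: noG.
  by exists g => //; apply/eqP.
rewrite k0 expn0 in ck.
have tGH : transversal_pair G H by split=> // h; apply: meet_holN_trivial ck.
have [//|inv] := model_or_inverting he tGH.
case: (boolP [forall x in G, (x.1 == 0%R) ==> mod4_1 (mul_part x)]) => [/forall_inP allM|nM].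
  have stabM x : x \in G -> x.1 = 0%R -> mod4_1 (mul_part x).
    by move=> Gx x0; move: (allM x Gx); rewrite x0 eqxx.
  have [H2 cG ES] := inverting_stab he tGH inv stabM.
  apply: Or44; split=> //.
  have [j le_je cj] := card_meet_holN he G.
  (* For |G ∩ N| at most 4, the derived subgroup, which lies in G ∩ N, either is all of it with
     order 4 or has order at most 2. In the latter case commutators with h0 are killed by 2 and a
     model exists. *)
  have [j3|j3] := leqP 3 j; first by left; rewrite cj (@leq_exp2l 2 3).
  have sDN := derived_sub_holN G.
  have leD : #|[~: G, G]| <= 2 ^ j by rewrite -cj subset_leq_card.
  have : #|[~: G, G]| %| 2 ^ j by rewrite -cj cardSg.
  case/(dvdn_pfactor _ _ (isT : prime 2)) => d le_dj cd.
  have [d2|d2] := leqP 2 d.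
    have [Ej Ed] : j = 2 /\ d = 2 by nlia.
    by right; rewrite cj cd Ej Ed.
  case: noM; have [h0 Hh0 [U0 R0 H1]] := inv.
  apply: (perm_model_inverting he tGH Hh0 U0 R0 H1) => _ x Gx.
  apply: (commutators_half (G := G)) => //; last exact: (subsetP sHG).
  by rewrite cd (@leq_exp2l 2 _ 1) // -ltnS.
case: noM; have [h0 Hh0 [U0 R0 H1]] := inv.
(* A stabiliser element that is 3 mod 4 contradicts the premise of the commutator condition. *)
apply: (perm_model_inverting he tGH Hh0 U0 R0 H1) => stabM.
case/negP: nM; apply/forall_inP => x Gx; apply/implyP => /eqP; exact: stabM.
Qed.
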